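(* If $G$ is a regular subdivision of a simple $3$-connected plane graph $R$ with $t(G) \geq 1$, then $\chi_c(G) \leq \lfloor \frac{3}{2}\Delta^*(G)\rfloor$.
   Context: Plane graphs may have multiple edges but no loops; a simple graph has no multiple edges. $G$ is a regular subdivision of $R$ if it is obtained from $R$ by replacing each edge of $R$ by a path of length $k+1$, for a constant integer $k\geq 0$. The degree of a face is the number of vertices incident with it; $\Delta^*(G)$ is the maximum face degree. $t(G)$ denotes the number of vertices of a longest path in $G$ all of whose vertices have degree $2$ (and $t(G)=0$ if there is no vertex of degree 2). A cyclic coloring of a plane graph is a vertex coloring in which any two distinct vertices incident with a common face receive distinct colors; $\chi_c(G)$ is the minimum number of colors in a cyclic coloring. *)

(* Defs.v *)
From mathcomp Require Import all_boot.

Set Implicit Arguments.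
Unset Strict Implicit.
Unset Printing Implicit Defensive.

(* Plane graphs are represented combinatorially, by rotation systems: every
   edge consists of two darts [d] and [opposite d], and [rotation] lists the
   darts leaving a given vertex in their cyclic order around that vertex.
   Multiple edges are allowed, loops are not. *)
Record rotation_graph := RotationGraph {
  vertex : finType;
  dart : finType;
  source : dart -> vertex;
  opposite : dart -> dart;
  rotation : dart -> dart;
  oppositeK : involutive opposite;
  loopless : forall d, source (opposite d) != source d;
  rotation_orbit : forall d d', fconnect rotation d d' = (source d == source d')
}.

Section RotationGraph.

Variable G : rotation_graph.
Implicit Types (d : dart G) (u v : vertex G) (S : {set vertex G}).
Implicit Types (F : {set dart G}).

Definition target d : vertex G := source (opposite d).

Definition edges : {set {set dart G}} := [set [set d; opposite d] | d : dart G].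

(* [next_on_face d] leaves the target of [d]; a face is the set of darts met by
   walking along its boundary with the face kept on one side. *)
Definition next_on_face d : dart G := rotation (opposite d).

Definition face_of d : {set dart G} := [set d' | fconnect next_on_face d d'].

Definition faces : {set {set dart G}} := [set face_of d | d : dart G].

Definition face_vertices F : {set vertex G} := [set source d | d in F].

Definition face_degree F : nat := #|face_vertices F|.

Definition max_face_degree : nat := \max_(F in faces) face_degree F.

Definition adjacent u v : bool :=
  [exists d : dart G, (source d == u) && (target d == v)].

Definition connected_outside S : Prop :=
  forall u v, u \notin S -> v \notin S ->
    connect [rel x y | [&& x \notin S, y \notin S & adjacent x y]] u v.

Definition connected_graph : Prop := connected_outside set0.

Definition k_connected (k : nat) : Prop :=
  k < #|vertex G| /\ forall S, #|S| < k -> connected_outside S.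

Definition simple_graph : Prop :=
  forall d d', source d = source d' -> target d = target d' -> d = d'.

Definition degree v : nat := #|[set d | source d == v]|.

Definition deg2_path (p : seq (vertex G)) : bool :=
  [&& uniq p, sorted adjacent p & all (fun v => degree v == 2) p].

(* The empty sequence contributes 0, the value taken when no vertex has
   degree 2. *)
Definition longest_deg2_path : nat :=
  \max_(n < #|vertex G|.+1 | [exists p : n.-tuple (vertex G), deg2_path p]) n.

Definition cyclic_coloring (n : nat) (c : vertex G -> 'I_n) : bool :=
  [forall F in faces,
    [forall u in face_vertices F,
      [forall v in face_vertices F, (u != v) ==> (c u != c v)]]].

Definition cyclically_colorable (n : nat) : bool :=
  [exists c : {ffun vertex G -> 'I_n}, cyclic_coloring c].

Lemma cyclically_colorable_ex : exists n, cyclically_colorable n.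
Proof.
exists #|vertex G|; apply/existsP; exists [ffun v => enum_rank v].
apply/forall_inP => F _; apply/forall_inP => u _; apply/forall_inP => v _.
by apply/implyP; rewrite !ffunE (inj_eq enum_rank_inj).
Qed.

Definition cyclic_chromatic_number : nat := ex_minn cyclically_colorable_ex.

End RotationGraph.

(* A connected rotation system is one of the sphere, i.e., comes from a drawing
   in the plane, exactly when Euler's formula V - E + F = 2 holds. The graph
   with one vertex and no edge is excluded, as its face carries no dart. *)
Record plane_graph := PlaneGraph {
  plane_rotation :> rotation_graph;
  plane_connected : connected_graph plane_rotation;
  plane_euler :
    #|vertex plane_rotation| + #|faces plane_rotation|
      = #|edges plane_rotation| + 2
}.

(* [f] embeds the vertices of [R] into those of [G], and
   [p d ord0, ..., p d ord_max] are the consecutive darts of the path of length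
   [k + 1] that replaces the dart [d] of [R]. The darts of [G] leaving a vertex
   [f v] keep the cyclic order of the darts of [R] leaving [v]. *)
Record subdivides (G R : plane_graph) (k : nat)
    (f : vertex R -> vertex G) (p : dart R -> 'I_k.+1 -> dart G) : Prop :=
  Subdivides {
  sub_vertex_inj : injective f;
  sub_dart_bij : bijective (fun di : dart R * 'I_k.+1 => p di.1 di.2);
  sub_opposite : forall d i, opposite (p d i) = p (opposite d) (rev_ord i);
  sub_start : forall d, source (p d ord0) = f (source d);
  sub_step : forall d (i j : 'I_k.+1), j = i.+1 :> nat ->
    source (p d j) = target (p d i);
  sub_inner_new : forall d (i : 'I_k.+1) v, 0 < i -> source (p d i) <> f v;
  sub_inner_inj : forall d d' (i j : 'I_k.+1), 0 < i -> 0 < j ->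
    source (p d i) = source (p d' j) ->
    (d' = d /\ j = i) \/ (d' = opposite d /\ i + j = k.+1);
  sub_vertex_cover : forall w,
    (exists v, w = f v) \/ (exists d (i : 'I_k.+1), 0 < i /\ w = source (p d i));
  sub_rotation : forall d, rotation (p d ord0) = p (rotation d) ord0
}.

Definition regular_subdivision (G R : plane_graph) : Prop :=
  exists (k : nat) (f : vertex R -> vertex G) (p : dart R -> 'I_k.+1 -> dart G),
    subdivides f p.

(* Main.v *)
Require Import Defs.
From mathcomp Require Import all_boot all_order all_fingroup all_algebra.
From mathcomp Require Import zify ring lra.

Set Implicit Arguments.
Unset Strict Implicit.
Unset Printing Implicit Defensive.

(* Let L be the maximum face length of R and k >= 1 the number of vertices put on
   each edge, so that Delta^*(G) = (k + 1) L. The faces of R are cycles and two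
   faces share at most one edge, so by Vizing's theorem the edges of R split into
   L + 1 classes such that no face has two edges in one class. The inner vertices
   of the edges in the first L classes receive kL colours, k for each class. The
   vertices of R are then coloured with 2L further colours, and finally every edge
   of the last class, which sees at most 2L - 1 vertices of R and no other edge of
   its class, takes k of the floor((k + 3) L / 2) colours not used in the first
   step.

   The 2L-colouring of R is greedy: every nonempty set S of vertices contains one
   that shares a face with fewer than 2L others. To see this, draw the incidences
   between S and the faces meeting S in at least two vertices as a bipartite plane
   graph. By 3-connectedness its faces have length at least 6, except those of
   length 4 arising from an edge of R inside S, so Euler's formula gives a vertex
   of positive curvature, which has few conflicts. *)

(** * Vizing's theorem *)

Section PathComponent.

Variables (T : finType) (r : rel T).
Hypothesis r_sym : symmetric r.
Hypothesis r_deg2 : forall u v1 v2 v3, r u v1 -> r u v2 -> r u v3 ->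
  v1 != v2 -> v3 = v1 \/ v3 = v2.

Definition end_vertex u := forall v1 v2, r u v1 -> r u v2 -> v1 = v2.

(** An inner vertex has both of its possible neighbours on the path already, and an end vertex its
    only one, so the path fills its component. *)
Lemma simple_path_closed x p : path r x p -> uniq (x :: p) ->
  x != last x p -> end_vertex x -> end_vertex (last x p) ->
  forall u v, u \in x :: p -> r u v -> v \in x :: p.
Proof.
move=> xp up x_last endx endl u v; rewrite inE => /predU1P[-> {u}|].
  case: p xp {up} x_last {endl} => [|b p] /= ; first by rewrite eqxx.
  by move=> /andP[xb _] _ xv; rewrite (endx _ _ xv xb) !inE eqxx orbT.
move=> /splitPr up'; case: up' up xp x_last endl => p1 p2 up.
rewrite cat_path /= => /and3P[xp1 au up2].
have a_in : last x p1 \in x :: p1 ++ u :: p2.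
  by rewrite -cat_cons mem_cat mem_last.
case: p2 up up2 a_in => [|b p2] up up2 a_in _.
  rewrite last_cat /= => endu uv.
  by rewrite (endu _ _ uv (_ : r u (last x p1))) // r_sym.
move: up2 => /= /andP[ub _] _ uv.
have ab : last x p1 != b.
  apply: contraTneq up => ab; rewrite -cat_cons cat_uniq.
  have -> : has [in x :: p1] [:: u, b & p2].
    by apply/hasP; exists b; [rewrite !inE eqxx orbT | rewrite -ab; apply: mem_last].
  by rewrite andbF.
rewrite r_sym in au.
case: (r_deg2 au ub uv ab) => -> //.
by rewrite -cat_cons mem_cat !inE eqxx !orbT.
Qed.

(** A simple path from [x] to [y] is a whole component, hence contains [z]. Were [z] an inner vertex
    of it, its two neighbours on the path would coincide. *)
Lemma component_end_vertices x y z :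
  end_vertex x -> end_vertex y -> end_vertex z ->
  connect r x y -> connect r x z -> x != y -> x != z -> y = z.
Proof.
move=> endx endy endz /connectP[p0 xp0 y_last] xz xy xz_neq.
case/shortenP: xp0 y_last => p xp up _ ylast.
rewrite ylast in xy endy *.
have closed_p := simple_path_closed xp up xy endx endy.
have zp : z \in x :: p.
  have cl : closed r [in x :: p].
    apply: (intro_closed (sym_connect_sym r_sym)) => u v uv up'.
    exact: closed_p up' uv.
  by rewrite -[_ \in _](closed_connect cl xz) inE eqxx.
move: zp; rewrite inE eq_sym (negPf xz_neq) /= => /splitPr zp.
case: zp up xp {xy endy closed_p ylast} => p1 p2 up; rewrite cat_path /= last_cat /=.
case: p2 up => [|b p2] up //= /and4P[_ az zb _].
rewrite r_sym in az; have ab := endz _ _ az zb.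
move: up; rewrite -cat_cons cat_uniq => /and3P[_ /hasPn hn _].
have := hn b; rewrite !inE eqxx orbT => /(_ isT).
by rewrite -ab -[_ || _]/(_ \in x :: p1) mem_last.
Qed.

End PathComponent.

Lemma sub_path_belast (T : eqType) (e e' : rel T) x p :
  (forall u v, u \in belast x p -> v \in p -> e u v -> e' u v) ->
  path e x p -> path e' x p.
Proof.
elim: p x => //= y p IHp x ee' /andP[xy yp]; apply/andP; split.
  by apply: ee' xy; rewrite inE eqxx.
by apply: IHp yp => u v u_p v_p; apply: ee'; rewrite inE ?u_p ?v_p orbT.
Qed.

Lemma path_prefix_first (T : eqType) (e : rel T) (P : pred T) x p :
  path e x p -> P (last x p) ->
  exists q, [/\ path e x q, subseq q p, P (last x q) & {in belast x q, forall u, ~~ P u}].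
Proof.
elim: p x => [|y p IHp] x /=; first by move=> _ Px; exists [::].
move=> /andP[xy yp] Pl; have [Px|nPx] := boolP (P x).
  by exists [::]; split=> //; apply: sub0seq.
have [q [yq qp Pq nPq]] := IHp y yp Pl.
exists (y :: q); split=> //=; rewrite ?xy ?eqxx //.
by move=> u; rewrite inE => /predU1P[->|/nPq].
Qed.

(** * Edge colourings, fans and Kempe chains *)

Section EdgeColoring.

Variables (T C : finType).
Implicit Types (e : rel T) (c : T -> T -> C) (x y u v w : T) (a b g : C).

(** Every ordered pair has a colour, but only pairs in [e] are constrained: once an edge is deleted
    from [e], its value is arbitrary. *)
Definition edge_coloring e c :=
  (forall u v, e u v -> c u v = c v u) /\
  (forall u v w, e u v -> e u w -> c u v = c u w -> v = w).

Definition same_edge x y u v :=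
  (u == x) && (v == y) || (u == y) && (v == x).

Definition delete_edge x y e u v := e u v && ~~ same_edge x y u v.

Definition misses e c u a := forall v, e u v -> c u v <> a.

Definition recolor x y a c u v := if same_edge x y u v then a else c u v.

Lemma same_edgeC x y u v : same_edge x y u v = same_edge x y v u.
Proof. by rewrite /same_edge /= orbC andbC [(v == y) && _]andbC. Qed.

Lemma delete_edge_sym x y e : symmetric e -> symmetric (delete_edge x y e).
Proof. by move=> se u v; rewrite /delete_edge /= se same_edgeC. Qed.

(* The invariant of a fan at [x]: the edge [x y] is the only uncoloured one,
   and a step from [u] leads to a [v] whose edge to [x] could move to [u]. *)
Definition fan_step e c x y : rel T :=
  [rel u v | [&& e x v, v != y &
     [forall w, delete_edge x y e u w ==> (c u w != c x v)]]].

Lemma fan_stepP e c x y u v :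
  reflect [/\ e x v, v != y & misses (delete_edge x y e) c u (c x v)]
          (fan_step e c x y u v).
Proof.
apply: (iffP and3P) => [[-> -> /forall_inP H]|[-> -> H]]; split=> //.
  by move=> w uw; apply/eqP/H.
by apply/forall_inP => w uw; apply/eqP/H.
Qed.

Section Fan.

Variables (e : rel T) (x : T).
Hypotheses (e_sym : symmetric e) (e_irr : irreflexive e).

Lemma e_neq u v : e u v -> u != v.
Proof. by apply: contraTneq => ->; rewrite e_irr. Qed.

Lemma recolor_edge_coloring c y a : e x y ->
  edge_coloring (delete_edge x y e) c ->
  misses (delete_edge x y e) c x a -> misses (delete_edge x y e) c y a ->
  edge_coloring e (recolor x y a c).
Proof.
move=> exy [csym cinj] ax ay; have xy := e_neq exy; split=> [u v uv|u v w uv uw].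
  rewrite /recolor [same_edge _ _ v u]same_edgeC; case: ifPn => // n_uv.
  by apply: csym; rewrite /delete_edge /same_edge /= uv.
rewrite /recolor; case: ifPn => uv1; case: ifPn => uw1.
- move: uv1 uw1 ; rewrite /same_edge /= => /orP[]/andP[/eqP-> /eqP->].
    by rewrite eqxx (negPf xy) orbF /= => /eqP.
  by rewrite eqxx eq_sym (negPf xy) /= => /eqP.
- have uw' : delete_edge x y e u w by rewrite /delete_edge /same_edge /= uw.
  move: uv1 ; rewrite /same_edge /= => /orP[]/andP[/eqP ux /eqP vy] acw.
    by rewrite ux in uw' acw; case: (ax _ uw').
  by rewrite ux in uw' acw; case: (ay _ uw').
- have uv' : delete_edge x y e u v by rewrite /delete_edge /same_edge /= uv.
  move: uw1 ; rewrite /same_edge /= => /orP[]/andP[/eqP ux /eqP vy] acw.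
    by rewrite ux in uv' acw; case: (ax _ uv').
  by rewrite ux in uv' acw; case: (ay _ uv').
- by apply: cinj; rewrite /delete_edge /same_edge /= ?uv ?uw.
Qed.

(** Induction along the fan: [x y] takes the colour of [x y1], which [y] misses. Now [x y1] is the
    uncoloured edge and the rest of the path is a fan for it. The last uncoloured edge can take [a],
    missing at both of its ends. *)
Lemma fan_rotation p c y a : e x y ->
  edge_coloring (delete_edge x y e) c ->
  path (fan_step e c x y) y p -> uniq (y :: p) ->
  misses (delete_edge x y e) c x a ->
  misses (delete_edge x y e) c (last y p) a ->
  exists c', edge_coloring e c'.
Proof.
elim: p c y => [|y1 p IHp] c y exy col_c.
  by move=> _ _ ax ay; exists (recolor x y a c); apply: recolor_edge_coloring.
move=> /= /andP[/fan_stepP[exy1 y1y my] yp] /andP[y_p up] ax al.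
have xy := e_neq exy; have xy1 := e_neq exy1.
have dxy1 : delete_edge x y e x y1.
  by rewrite /delete_edge /same_edge /= exy1 eqxx (negPf y1y) (negPf xy).
have recE u v : u != x -> u != y -> recolor x y (c x y1) c u v = c u v.
  by move=> ux uy; rewrite /recolor /same_edge /= (negPf ux) (negPf uy).
have delS u v : u != x -> u != y -> delete_edge x y1 e u v -> delete_edge x y e u v.
  by move=> ux uy; rewrite /delete_edge /same_edge /= (negPf ux) (negPf uy) /= => /andP[->].
have missS u g : u != x -> u != y -> misses (delete_edge x y e) c u g ->
    misses (delete_edge x y1 e) (recolor x y (c x y1) c) u g.
  by move=> ux uy mu v uv; rewrite recE //; apply/mu/delS.
have eN u : u \in y1 :: p -> (u != x) && (u != y).
  move=> u_p; apply/andP; split; last by apply: contraNneq y_p => <-.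
  rewrite eq_sym; apply: e_neq; move: u_p; rewrite inE => /predU1P[->//|].
  move=> u_p; case/splitPr: u_p yp {y_p up al} => p1 p2.
  by rewrite cat_path /= => /and3P[_ /fan_stepP[]].
have col1 : edge_coloring (delete_edge x y1 e) (recolor x y (c x y1) c).
  case: col_c => csym cinj; split=> [u v|u v w].
    move=> /andP[uv uv1]; rewrite /recolor [same_edge _ _ v u]same_edgeC.
    by case: ifPn => // n_uv; apply: csym; rewrite /delete_edge /same_edge /= uv.
  move=> /andP[uv uv1] /andP[uw uw1]; rewrite /recolor.
  case: ifPn => uv2; case: ifPn => uw2.
  - move: uv2 uw2 ; rewrite /same_edge /= => /orP[]/andP[/eqP-> /eqP->].
      by rewrite eqxx (negPf xy) orbF /= => /eqP.
    by rewrite eqxx eq_sym (negPf xy) /= => /eqP.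
  - have uw' : delete_edge x y e u w by rewrite /delete_edge /same_edge /= uw.
    move: uv2 ; rewrite /same_edge /= => /orP[]/andP[/eqP ux /eqP vy] acw; rewrite ux in uw' acw uw1.
      have y1w := cinj _ _ _ dxy1 uw' acw.
      by rewrite /same_edge -y1w !eqxx in uw1.
    by case: (my _ uw').
  - have uv' : delete_edge x y e u v by rewrite /delete_edge /same_edge /= uv.
    move: uw2 ; rewrite /same_edge /= => /orP[]/andP[/eqP ux /eqP vy] acw; rewrite ux in uv' acw uv1.
      have y1v := cinj _ _ _ dxy1 uv' (esym acw).
      by rewrite /same_edge -y1v !eqxx in uv1.
    by case: (my _ uv').
  - by apply: cinj; rewrite /delete_edge /same_edge /= ?uv ?uw.
apply: (IHp (recolor x y (c x y1) c) y1) => //.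
- apply: sub_path_belast yp => u v u_p v_p /fan_stepP[exv _ mu].
  have [ux uy] : (u != x) /\ (u != y) by apply/andP/eN/mem_belast.
  have [vx vy] : (v != x) /\ (v != y) by apply/andP/eN; rewrite inE v_p orbT.
  apply/fan_stepP; split=> //; first by case/andP: up => /memPn ->.
  suff -> : recolor x y (c x y1) c x v = c x v by apply: missS.
  by rewrite /recolor /same_edge /= (negPf vy) (negPf xy) andbF.
- move=> w /andP[xw nxw]; rewrite /recolor; case: ifPn => // xwy; first exact: ax.
  by apply: ax; rewrite /delete_edge /same_edge /= xw.
- have [lx ly] : (last y1 p != x) /\ (last y1 p != y) by apply/andP/eN/mem_last.
  exact: missS.
Qed.

Section Kempe.

Variables (c : T -> T -> C) (y : T) (a b : C).
Hypotheses (exy : e x y) (col_c : edge_coloring (delete_edge x y e) c).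
Hypothesis ax : misses (delete_edge x y e) c x a.

Let e' := delete_edge x y e.

Definition kempe_rel : rel T := [rel u v | e' u v && ((c u v == a) || (c u v == b))].

Lemma kempe_rel_sym : symmetric kempe_rel.
Proof.
move=> u v; rewrite /kempe_rel /= /e' delete_edge_sym //.
by case: (boolP (delete_edge x y e v u)) => //= uv; rewrite (col_c.1 _ _ uv).
Qed.

(** Testing only the first argument is enough: both ends of an edge coloured [a] or [b] lie in one
    component, and [tperm a b] fixes all other colours. *)
Definition kempe_swap (z : T) u v : C :=
  if connect kempe_rel z u then tperm a b (c u v) else c u v.

Lemma kempe_swap_coloring z : edge_coloring e' (kempe_swap z).
Proof.
case: (col_c) => csym cinj; split=> [u v uv|u v w uv uw]; rewrite /kempe_swap.
  have cuv := csym _ _ uv; rewrite -cuv.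
  have [k_uv|nk] := boolP (kempe_rel u v).
    have -> // : connect kempe_rel z u = connect kempe_rel z v.
    by apply: (same_connect1r (sym_connect_sym kempe_rel_sym)).
  move: nk; rewrite /kempe_rel /= uv /= negb_or => /andP[ca cb].
  by rewrite tpermD 1?eq_sym // !if_same.
by case: ifP => _; [move=> /perm_inj|]; apply: cinj.
Qed.

Lemma kempe_swap_misses z u g :
  misses e' c u (if connect kempe_rel z u then tperm a b g else g) ->
  misses e' (kempe_swap z) u g.
Proof.
move=> mu v uv; move: (mu v uv); rewrite /kempe_swap.
by case: ifP => // _ neq cg; apply: neq; rewrite -cg tpermK.
Qed.

(** Swapping on the component of the last fan vertex frees [a] there and leaves the colours at [x]
    alone. A fan step could only break at an earlier vertex of that component missing [b], which the
    last hypothesis excludes; so the fan can be rotated with [a]. *)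
Lemma kempe_fan p :
  path (fan_step e c x y) y p -> uniq (y :: p) ->
  misses e' c (last y p) b ->
  ~~ connect kempe_rel (last y p) x ->
  (forall u, u \in belast y p -> misses e' c u b ->
     ~~ connect kempe_rel (last y p) u) ->
  exists c', edge_coloring e c'.
Proof.
move=> yp up mb x_notin nb; set z := last y p in mb x_notin nb.
apply: (fan_rotation (p := p) (a := a) exy (kempe_swap_coloring z)) => //.
- apply: sub_path_belast yp => u v u_p v_p /fan_stepP[exv vy mu].
  have sw : kempe_swap z x v = c x v by rewrite /kempe_swap (negPf x_notin).
  apply/fan_stepP; split; rewrite // sw; apply: kempe_swap_misses.
  case: ifPn => // zu; rewrite tpermD //.
    apply/eqP => /esym; apply: ax; rewrite /delete_edge /same_edge /= exv eqxx (negPf vy).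
    by rewrite (negPf (e_neq exy)).
  apply/eqP => bc; rewrite -bc in mu.
  by have := nb u u_p mu; rewrite zu.
- by apply: kempe_swap_misses; rewrite (negPf x_notin).
- by apply: kempe_swap_misses; rewrite connect0 tpermL.
Qed.

Lemma kempe_end_vertex g u : (g == a) || (g == b) -> misses e' c u g ->
  end_vertex kempe_rel u.
Proof.
move=> gab mg v1 v2 /andP[uv1 c1] /andP[uv2 c2]; apply: (col_c.2 u) => //.
have [n1 n2] := (mg _ uv1, mg _ uv2).
by case/orP: gab => /eqP gE; rewrite gE in n1 n2;
  case/orP: c1 => /eqP c1; case/orP: c2 => /eqP c2; rewrite ?c1 ?c2.
Qed.

(* At most one of [y1], [y2] is joined to [x] by an [a]/[b]-chain: the other chain
   can be swapped, but only the first vertex missing [b] on the path of the fan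
   (or the second one, if the first is joined to [x]) keeps the fan intact. *)
Lemma kempe_two_missing y1 y2 :
  connect (fan_step e c x y) y y1 -> connect (fan_step e c x y) y y2 ->
  y1 != y2 -> misses e' c y1 b -> misses e' c y2 b ->
  exists c', edge_coloring e c'.
Proof.
move=> yy1 yy2 y12 m1 m2.
pose P u := [forall w, e' u w ==> (c u w != b)].
have PP u : reflect (misses e' c u b) (P u).
  apply: (iffP forall_inP) => mu w uw; first by apply/eqP/mu.
  by apply/eqP/mu.
have fan_edge p u : path (fan_step e c x y) y p -> u \in y :: p -> e x u.
  move=> yp; rewrite inE => /predU1P[->//|u_p]; case/splitPr: u_p yp => p1 p2.
  by rewrite cat_path /= => /and3P[_ /fan_stepP[]].
have pre (Q : pred T) u : connect (fan_step e c x y) y u -> Q u ->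
    exists q, [/\ path (fan_step e c x y) y q, uniq (y :: q), Q (last y q)
                & {in belast y q, forall v, ~~ Q v}].
  move=> /connectP[p0 yp0 ul] Qu; case/shortenP: yp0 ul => p yp up _ ul.
  rewrite ul in Qu; have [q [yq qp Qq nQ]] := path_prefix_first yp Qu.
  exists q; split=> //; move: up => /= /andP[y_p up].
  by rewrite (subseq_uniq qp up) andbT; apply: contra y_p => /(mem_subseq qp).
have [p [yp up Pl nP]] := pre P y1 yy1 (introT (PP _) m1).
have [x_in|] := boolP (connect kempe_rel (last y p) x); last first.
  move=> x_notin; apply: (kempe_fan yp up) => //; first exact/PP.
  by move=> u u_p /PP Pu; case/negP: (nP u u_p).
pose Q u := P u && (u != last y p).
have [u yu Qu] : exists2 u, connect (fan_step e c x y) y u & Q u.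
  have [y1l|y1l] := eqVneq y1 (last y p).
    by exists y2; rewrite // /Q (introT (PP _) m2) -y1l eq_sym.
  by exists y1; rewrite // /Q (introT (PP _) m1).
have [q [yq uq /andP[Pq ql] nQ]] := pre Q u yu Qu.
have csym := sym_connect_sym kempe_rel_sym.
(* [x] misses [a] and both fan ends miss [b], so all three are end vertices of chains; a single
   component cannot contain three of them. *)
have pq : ~~ connect kempe_rel (last y p) (last y q).
  apply: contra ql => pq; apply/eqP.
  apply: (@component_end_vertices _ _ kempe_rel_sym _ x).
  - move=> w v1 v2 v3 /andP[w1 c1] /andP[w2 c2] /andP[w3 c3] v12.
    have inj := col_c.2 w.
    case/orP: c1 c2 c3 => /eqP c1 /orP[]/eqP c2 /orP[]/eqP c3;
      try (by case/eqP: v12; apply: inj; rewrite // c1 c2);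
      try (by left; apply: inj; rewrite // c3 c1);
      by right; apply: inj; rewrite // c3 c2.
  - by apply: (kempe_end_vertex (g := a)); rewrite ?eqxx.
  - by apply: (kempe_end_vertex (g := b)); rewrite ?eqxx ?orbT //; apply/PP.
  - by apply: (kempe_end_vertex (g := b)); rewrite ?eqxx ?orbT //; apply/PP.
  - by rewrite csym in x_in; apply: connect_trans pq.
  - by rewrite csym.
  - by apply/e_neq/(fan_edge q); rewrite ?mem_last.
  - by apply/e_neq/(fan_edge p); rewrite ?mem_last.
apply: (kempe_fan yq uq); first exact/PP.
- apply: contra pq => qx; rewrite csym; apply: connect_trans qx _.
  by rewrite csym.
- move=> v v_q /PP Pv; have := nQ v v_q; rewrite /Q Pv /= negbK => /eqP ->.
  by rewrite csym.
Qed.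

End Kempe.

Lemma missing_color (e' : rel T) (c : T -> T -> C) u :
  #|[set v | e' u v]| < #|C| -> exists a, misses e' c u a.
Proof.
move=> ltdeg; have: ~~ ([set: C] \subset c u @: [set v | e' u v]).
  apply/negP => /subset_leq_card; rewrite cardsT => /(leq_trans ltdeg).
  by rewrite ltnNge leq_imset_card.
case/subsetPn=> a _ na; exists a => v uv cuv; case/negP: na.
by apply/imsetP; exists v; rewrite ?inE.
Qed.

(** Let each fan vertex [u] choose a missing colour [mu u]. If some [mu u] is also missing at [x],
    rotate the fan. Otherwise sending [u] to the neighbour of [x] across the edge coloured [mu u]
    maps the fan vertices to fan vertices other than [y]; by pigeonhole two of them miss the same
    colour, and a Kempe swap applies. *)
Lemma extend_edge_coloring c y : e x y ->
  (forall u, #|[set v | e u v]| < #|C|) ->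
  edge_coloring (delete_edge x y e) c ->
  exists c', edge_coloring e c'.
Proof.
move=> exy deg_e col_c; set e' := delete_edge x y e in col_c.
have xy := e_neq exy.
have sub_deg u : #|[set v | e' u v]| < #|C|.
  apply: leq_ltn_trans (deg_e u); apply/subset_leq_card/subsetP => v.
  by rewrite !inE => /andP[].
have [mu mu_miss] := fin_all_exists (fun u => missing_color c (sub_deg u)).
pose Y := [set u | connect (fan_step e c x y) y u].
(* The default [y] is never taken on [Y] in the second case, where each [mu u] occurs at [x]. *)
pose h u := odflt y [pick w | e' x w && (c x w == mu u)].
have [/exists_inP[u yu /forall_inP mxu]|/exists_inPn noY] :=
    boolP [exists u in Y, [forall w in e' x, c x w != mu u]].
  move: yu; rewrite inE => /connectP[p0 yp0 ul].
  case/shortenP: yp0 ul => p yp up _ ul.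
  apply: (fan_rotation (a := mu u) exy col_c yp up).
    by move=> w xw; apply/eqP/mxu.
  by rewrite -ul; apply: mu_miss.
have hP u : u \in Y -> e' x (h u) /\ c x (h u) = mu u.
  move=> uY; rewrite /h; case: pickP => [w /andP[xw /eqP]//|none].
  have /negP[] := noY u uY; apply/forall_inP => w xw.
  by have := none w; rewrite [e' x w]xw /= => ->.
have hY u : u \in Y -> h u \in Y :\ y.
  move=> uY; have [/andP[xh nh] ch] := hP u uY.
  have hy : h u != y by apply: contra nh => /eqP->; rewrite /same_edge !eqxx.
  rewrite !inE hy /=; move: (uY); rewrite inE => yu; apply: connect_trans yu (connect1 _).
  by apply/fan_stepP; split; rewrite // ch; apply: mu_miss.
have yY : y \in Y by rewrite inE connect0.
have /dinjectivePn[u1 u1Y [u2 /andP[u12 u2Y] h12]] : ~~ dinjectiveb h [in Y].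
  apply/negP => /dinjectiveP inj_h; have := cardsD1 y Y; rewrite yY add1n => cY.
  have: h @: Y \subset Y :\ y by apply/subsetP => _ /imsetP[u uY ->]; apply: hY.
  move/subset_leq_card; by rewrite card_in_imset // cY ltnn.
have [a ax] := missing_color c (sub_deg x).
have [[xh1 c1] [_ c2]] := (hP _ u1Y, hP _ u2Y).
have mu12 : mu u1 = mu u2 by rewrite -c1 h12 c2.
apply: (@kempe_two_missing c y a (mu u1) exy col_c ax u1 u2).
- by move: u1Y; rewrite inE.
- by move: u2Y; rewrite inE.
- by rewrite eq_sym.
- exact: mu_miss.
- by rewrite mu12; apply: mu_miss.
Qed.

End Fan.

Theorem vizing_edge_coloring e (c0 : C) : symmetric e -> irreflexive e ->
  (forall u, #|[set v | e u v]| < #|C|) -> exists c, edge_coloring e c.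
Proof.
have [n] := ubnP #|[set uv | e uv.1 uv.2]|.
elim: n e => // n IHn e ltn e_sym e_irr deg_e.
have [/existsP[x /existsP[y exy]]|noe] := boolP [exists x, exists y, e x y].
  have [| | | |c col_c] := IHn (delete_edge x y e).
  - rewrite -ltnS; apply: leq_trans ltn; rewrite ltnS; apply: proper_card; apply/properP; split.
      by apply/subsetP => uv; rewrite !inE => /andP[].
    by exists (x, y); rewrite !inE //= /delete_edge /same_edge exy !eqxx.
  - exact: delete_edge_sym.
  - by move=> u; rewrite /delete_edge /same_edge /= e_irr.
  - move=> u; apply: leq_ltn_trans (deg_e u); apply/subset_leq_card/subsetP => v.
    by rewrite !inE => /andP[].
  exact: (extend_edge_coloring e_sym e_irr exy deg_e col_c).
exists (fun _ _ => c0); split=> // u v w uv.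
by case/existsP: noe; exists u; apply/existsP; exists v.
Qed.

End EdgeColoring.

(** * Euler's formula for sets of corners *)

Lemma card_imset_U1 (U V : finType) (f : U -> V) (x : U) (A : {set U}) :
  #|f @: (x |: A)| = (f x \notin f @: A) + #|f @: A|.
Proof. by rewrite imsetU1 cardsU1. Qed.

Lemma connect_invariant (T : finType) (r : rel T) (P : pred T) x y :
  (forall u v, r u v -> P u -> P v) -> connect r x y -> P x -> P y.
Proof.
move=> rP /connectP[p + ->]; elim: p x => //= z p IHp x /andP[xz zp] Px.
exact: IHp zp (rP _ _ xz Px).
Qed.

(** * Counting connected components *)

Section Classes.

Variable T : finType.
Implicit Types (r : rel T) (a b x y : T).

Definition class_of r x : {set T} := [set y | connect r x y].

Definition classes r : {set {set T}} := [set class_of r x | x : T].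

Lemma eq_class_of r x y : symmetric r -> (class_of r x == class_of r y) = connect r x y.
Proof.
move=> r_sym; apply/eqP/idP => [eq_xy|xy].
  have: y \in class_of r y by rewrite inE.
  by rewrite -eq_xy inE.
by apply/setP => z; rewrite !inE; apply: (same_connect (sym_connect_sym r_sym)).
Qed.

(** The new edge can only merge the classes of [a] and [b]. Mapping each old class to the new class
    around it is therefore injective once the class of [b] is dropped, and without dropping it if
    [a] and [b] were already connected. *)
Lemma card_classes_add_edge r r' a b :
  symmetric r -> symmetric r' -> subrel r r' ->
  (forall x y, r' x y -> [|| r x y, (x == a) && (y == b) | (x == b) && (y == a)]) ->
  #|classes r| <= #|classes r'| + ~~ connect r a b.
Proof.
move=> r_sym r'_sym rr' r'r.
have sc := sym_connect_sym r_sym.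
pose AB x := connect r a x || connect r b x.
pose J x y := connect r x y || (AB x && AB y).
have J_conn x y : connect r' x y -> J x y.
  move=> /connectP[p + ->]; elim: p x => [|z p IHp] x /=; first by rewrite /J connect0.
  move=> /andP[/r'r xz /IHp]; rewrite /J => /orP[] zl; case/or3P: xz => [xz|/andP[/eqP-> /eqP zE]|/andP[/eqP-> /eqP zE]].
  - by rewrite (connect_trans (connect1 xz) zl).
  - by rewrite /AB connect0 -zE zl !orbT.
  - by rewrite /AB connect0 -zE zl !orbT.
  - case/andP: zl => ABz ->; rewrite andbT; apply/orP; right.
    have zx : connect r z x by rewrite sc connect1.
    by case/orP: ABz => /connect_trans/(_ zx) xx; rewrite /AB xx ?orbT.
  - by case/andP: zl => _ ->; rewrite /AB connect0 !orbT.
  - by case/andP: zl => _ ->; rewrite /AB connect0 !orbT.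
pose g (X : {set T}) := [set y | [exists x in X, connect r' x y]].
have gE x : g (class_of r x) = class_of r' x.
  apply/setP => y; rewrite !inE; apply/exists_inP/idP => [[z]|xy].
    rewrite inE => xz; apply: connect_trans; apply: connect_sub xz => u v uv.
    exact/connect1/rr'.
  by exists x; rewrite ?inE.
pose D := if connect r a b then classes r else classes r :\ class_of r b.
have DP X : X \in D -> exists2 x, X = class_of r x & ~~ connect r a b -> ~~ connect r b x.
  rewrite /D; case: ifP => ab; first by case/imsetP=> x _ ->; exists x.
  case/setD1P=> Xb /imsetP[x _ XE]; exists x => // _; move: Xb.
  by rewrite XE eq_class_of // sc.
have g_inj : {in D &, injective g}.
  move=> X Y /DP[x -> nx] /DP[y -> ny]; rewrite !gE => /eqP.
  rewrite eq_class_of // => /J_conn /orP[xy|/andP[ABx ABy]].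
    by apply/eqP; rewrite eq_class_of.
  apply/eqP; rewrite eq_class_of //; move: ABx ABy nx ny; rewrite /AB.
  have [ab ABx ABy _ _|nab ABx ABy /(_ isT) nx /(_ isT) ny] := boolP (connect r a b).
    have aE z : connect r a z || connect r b z -> connect r a z.
      by case/orP=> // /(connect_trans ab).
    by apply: connect_trans (aE y ABy); rewrite sc aE.
  rewrite (negPf nx) (negPf ny) !orbF in ABx ABy.
  by apply: connect_trans ABy; rewrite sc.
have: g @: D \subset classes r'.
  by apply/subsetP => _ /imsetP[X /DP[x -> _] ->]; rewrite gE imset_f.
move/subset_leq_card; rewrite card_in_imset // /D; case: ifP => _ leD; first by rewrite addn0.
by rewrite (cardsD1 (class_of r b)) imset_f // addnC leq_add2r.
Qed.

Lemma card_classes_connect r :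
  (forall x y, connect r x y) -> #|classes r| <= 1.
Proof.
move=> conn; apply/card_le1P => _ /imsetP[x _ ->] X; apply/imsetP/eqP => [[y _ ->]|->].
  by apply/setP => z; rewrite !inE !conn.
by exists x.
Qed.

End Classes.

(** * Faces and corners of a rotation system *)

Section Rotation.

Variable G : rotation_graph.
Implicit Types (d : dart G) (v : vertex G) (A : {set dart G}).

Lemma source_rotation d : source (rotation d) = source d.
Proof. by apply/esym/eqP; rewrite -rotation_orbit fconnect1. Qed.

(** Each dart is reached from its own image under [rotation], so [rotation] is onto and, on a finite
    set, injective. *)
Lemma rotation_inj : injective (@rotation G).
Proof.
have surj d : d \in codom (@rotation G).
  have: fconnect (@rotation G) (rotation d) d.
    by rewrite rotation_orbit source_rotation.
  by move/iter_findex; rewrite -iterSr iterS => <-; apply: codom_f.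
have /image_injP inj : #|image (@rotation G) predT| == #|dart G|.
  by apply/eqP/eq_card => d; rewrite -[RHS]/true; apply: surj.
by move=> d1 d2; apply: inj.
Qed.

Lemma next_on_face_inj : injective (@next_on_face G).
Proof. by move=> d1 d2 /rotation_inj/(can_inj (@oppositeK G)). Qed.

Lemma source_next d : source (next_on_face d) = target d.
Proof. exact: source_rotation. Qed.

Lemma target_opposite d : target (opposite d) = source d.
Proof. by rewrite /target oppositeK. Qed.

Lemma target_neq_source d : target d != source d.
Proof. exact: loopless. Qed.

Lemma opposite_neq d : opposite d != d.
Proof. by apply: contraNneq (loopless d) => ->. Qed.

Lemma eq_face_of d d' : (face_of d == face_of d') = fconnect (@next_on_face G) d d'.
Proof.
apply/eqP/idP => [eq_dd|dd'].
  have: d' \in face_of d' by rewrite inE connect0.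
  by rewrite -eq_dd inE.
apply/setP => z; rewrite !inE.
exact: (same_connect (fconnect_sym next_on_face_inj)).
Qed.

Lemma mem_face_of d d' : (d' \in face_of d) = (face_of d' == face_of d).
Proof. by rewrite inE -eq_face_of eq_sym. Qed.

Lemma face_of_next d : face_of (next_on_face d) = face_of d.
Proof. by apply/esym/eqP; rewrite eq_face_of fconnect1. Qed.

Lemma face_of_rotation d : face_of (rotation d) = face_of (opposite d).
Proof. by rewrite -(face_of_next (opposite d)) /next_on_face oppositeK. Qed.

(* The dart [d] stands for the corner of [face_of d] at [source d], which lies
   between [d] and the dart preceding it in the rotation. [corner_rel A] glues
   two edges along every corner outside [A]: its classes are the faces of the
   plane graph drawn with the vertices and the faces of [G] as nodes and the
   corners of [A] as edges. *)
Definition corner_rel A : rel (dart G) :=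
  [rel x y | [|| y == opposite x, (x == rotation y) && (x \notin A)
              | (y == rotation x) && (y \notin A)]].

Lemma corner_rel_sym A : symmetric (corner_rel A).
Proof.
move=> x y; rewrite /corner_rel /=.
have -> : (x == opposite y) = (y == opposite x).
  by rewrite -[LHS](inj_eq (can_inj (@oppositeK G))) oppositeK eq_sym.
by congr orb; apply: orbC.
Qed.

Lemma corner_rel_opposite A d : corner_rel A d (opposite d).
Proof. by rewrite /corner_rel /= eqxx. Qed.

Lemma corner_rel_rotation A d : rotation d \notin A -> corner_rel A d (rotation d).
Proof. by move=> nA; rewrite /corner_rel /= eqxx nA !orbT. Qed.

(** Turning around the vertex from [d] is a chain of gluings; the only corner that could interrupt
    it is [d], where the turn starts afresh. *)
Lemma connect_around_vertex A d d' : (forall x, x \in A -> source x = source d -> x = d) ->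
  source d' = source d -> connect (corner_rel A) d d'.
Proof.
move=> Ad /esym/eqP; rewrite -rotation_orbit => /iter_findex <-.
elim: (findex _ _ _) => //= n IHn; set y := iter n _ d in IHn *.
have sy : source (rotation y) = source d.
  by rewrite source_rotation /y; elim: (n) => //= m IHm; rewrite source_rotation.
have [inA|notA] := boolP (rotation y \in A); first by rewrite (Ad _ inA).
by apply: connect_trans IHn (connect1 _); apply: corner_rel_rotation.
Qed.

Lemma connect_around_face A d d' : (forall x, x \in A -> face_of x = face_of d -> x = d) ->
  face_of d' = face_of d -> connect (corner_rel A) d d'.
Proof.
move=> Ad /esym/eqP; rewrite eq_face_of => /iter_findex <-.
elim: (findex _ _ _) => //= n IHn; set y := iter n _ d in IHn *.
have sy : face_of (next_on_face y) = face_of d.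
  by rewrite face_of_next /y; elim: (n) => //= m IHm; rewrite face_of_next.
have [inA|notA] := boolP (next_on_face y \in A); first by rewrite (Ad _ inA).
apply: connect_trans IHn (connect_trans (connect1 (corner_rel_opposite A y)) _).
by apply/connect1/corner_rel_rotation.
Qed.

(** Euler's relation E + 2 <= V + F for the bipartite plane graph with edge set [A]. It is an
    inequality because that graph may be disconnected. *)
Definition corner_euler A : bool :=
  #|A| + 2 <= #|(@source G) @: A| + #|(@face_of G) @: A| + #|classes (corner_rel A)|.

(* If [d] was the last corner at its vertex or on its face, its two sides were
   already glued around that vertex or face, so no class disappears with it. *)
Lemma corner_euler_remove A d : d \notin A ->
  (source d \in (@source G) @: A) || (face_of d \in (@face_of G) @: A) ->
  corner_euler (d |: A) -> corner_euler A.
Proof.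
move=> dA touch; rewrite /corner_euler cardsU1 dA !card_imset_U1 => IH.
pose d0 := finv (@rotation G) d.
have rd0 : rotation d0 = d by apply: f_finv; apply: rotation_inj.
(* Taking [d] out of the set adds a single gluing, that of [d] with its predecessor [d0] in the
   rotation. *)
have le_cl : #|classes (corner_rel (d |: A))| <=
    #|classes (corner_rel A)| + ~~ connect (corner_rel (d |: A)) d d0.
  apply: card_classes_add_edge; try exact: corner_rel_sym.
    move=> x y; rewrite /corner_rel /= !inE !negb_or.
    by case/or3P => [->//|/and3P[-> _ ->]|/and3P[-> _ ->]]; rewrite ?orbT.
  move=> x y /or3P[/eqP->|/andP[/eqP xE nA]|/andP[/eqP yE nA]].
  - by rewrite /corner_rel /= eqxx.
  - have [xd|xd] := eqVneq x d; last by rewrite /corner_rel /= !inE !negb_or xd nA -xE eqxx ?orbT.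
    have /rotation_inj <- : rotation d0 = rotation y by rewrite rd0 -xd.
    by rewrite eqxx orbT.
  - have [yd|yd] := eqVneq y d; last by rewrite /corner_rel /= !inE !negb_or yd nA -yE eqxx ?orbT.
    have /rotation_inj <- : rotation d0 = rotation x by rewrite rd0 -yd.
    by rewrite eqxx !orbT.
have sd0 : source d0 = source d by rewrite -rd0 source_rotation.
have conn : (source d \notin (@source G) @: A) || (face_of d \notin (@face_of G) @: A) ->
    connect (corner_rel (d |: A)) d d0.
  case/orP=> nd.
    apply: connect_around_vertex => // x; rewrite !inE => /predU1P[//|xA] sx.
    by case/negP: nd; rewrite -sx imset_f.
  apply: connect_trans (_ : connect _ _ (opposite d0)) _; last first.
    by apply: connect1; rewrite corner_rel_sym corner_rel_opposite.
  apply: connect_around_face => [x|]; last first.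
    by rewrite -(face_of_next (opposite d0)) /next_on_face oppositeK rd0.
  rewrite !inE => /predU1P[//|xA] sx.
  by case/negP: nd; rewrite -sx imset_f.
move: IH le_cl conn touch.
case: (source d \in _); case: (face_of d \in _) => //= IH le_cl conn _.
- by case: (connect _ _ _) le_cl => /=; lia.
- by move: le_cl; rewrite conn //=; lia.
- by move: le_cl; rewrite conn //=; lia.
Qed.

End Rotation.

(** * Euler's inequality for every nonempty set of corners *)

Section CornerEuler.

Variable R : plane_graph.
Implicit Types (d : dart R) (A : {set dart R}).

Lemma source_closed_setT A d0 : d0 \in A ->
  (forall x y, x \in A -> source y = source x -> y \in A) ->
  (forall x, x \in A -> opposite x \in A) -> A = setT.
Proof.
move=> d0A srcA oppA; apply/setP => d; rewrite inE.
have: connect [rel x y | [&& x \notin set0, y \notin set0 & adjacent x y]]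
    (source d0) (source d) by apply: plane_connected; rewrite inE.
move/(connect_invariant (P := [pred v | [forall y, (source y == v) ==> (y \in A)]])).
move=> inv; have /forall_inP -> // : [forall y, (source y == source d) ==> (y \in A)].
apply: inv => [u v|]; last by apply/forall_inP => y /eqP; exact: srcA.
case/and3P=> _ _ /existsP[y /andP[/eqP yu /eqP yv]] /forall_inP uA.
apply/forall_inP => z /eqP zv; apply: (srcA (opposite y)).
  by apply/oppA/uA; rewrite yu.
by rewrite zv -yv.
Qed.

Lemma vertex_has_dart d0 (v : vertex R) : exists d, source d = v.
Proof.
have: connect [rel x y | [&& x \notin set0, y \notin set0 & adjacent x y]]
    (source d0) v by apply: plane_connected; rewrite inE.
move/(connect_invariant (P := [pred v | [exists y, source y == v]])) => inv.
suff /existsP[d /eqP] : [exists y, source y == v] by exists d.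
apply: inv => [u w|]; last by apply/existsP; exists d0.
case/and3P=> _ _ /existsP[y /andP[_ /eqP yw]] _.
by apply/existsP; exists (opposite y); rewrite -yw.
Qed.

(** With all corners present only opposite darts are glued, so the classes are the edges of [R]. As
    there are at most 2E darts, Euler's formula for [R] gives the claim. *)
Lemma corner_euler_setT d0 : corner_euler [set: dart R].
Proof.
rewrite /corner_euler.
have -> : classes (corner_rel [set: dart R]) = edges R.
  apply: eq_imset => x; apply/setP => y; rewrite !inE; apply/idP/idP.
    move=> xy; apply: (connect_invariant (P := [pred y | (y == x) || (y == opposite x)])) xy _.
      move=> u v; rewrite /corner_rel /= !inE !andbF !orbF => /eqP -> /orP[]/eqP->.
        by rewrite eqxx orbT.
      by rewrite oppositeK eqxx.
    by rewrite /= eqxx.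
  by case/orP=> /eqP->; rewrite ?connect0 // connect1 // corner_rel_opposite.
have -> : (@source R) @: setT = setT.
  apply/setP => v; rewrite [RHS]inE; have [d <-] := vertex_has_dart d0 v.
  by rewrite imset_f ?inE.
have -> : (@face_of R) @: setT = faces R.
  by apply/setP => F; apply/imsetP/imsetP => -[d _ ->]; exists d.
have leD : #|[set: dart R]| <= #|edges R| * 2.
  have cov : cover (edges R) = setT.
    apply/setP => d; rewrite [RHS]inE; apply/bigcupP.
    by exists [set d; opposite d]; [apply: imset_f | rewrite !inE eqxx].
  rewrite -cov; apply: leq_trans (leq_card_cover _).1 _.
  rewrite -sum_nat_const; apply: leq_sum => _ /imsetP[d _ ->].
  by rewrite cards2; case: (_ != _).
rewrite [#|[set: vertex R]|]cardsT plane_euler addnAC leq_add2r.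
by rewrite (leq_trans leD) // muln2 addnn.
Qed.

(** Induction on the number of missing corners: add a corner sharing a vertex or a face with [A],
    and remove it again by [corner_euler_remove]. If there is none, [A] is closed under moving
    around vertices and faces, so it is everything by connectedness. *)
Theorem corner_eulerP A : A != set0 -> corner_euler A.
Proof.
have [n] := ubnP #|~: A|; elim: n A => // n IHn A ltn A0.
have [d0 d0A] := set0Pn _ A0.
have [->|AT] := eqVneq A setT; first exact: corner_euler_setT d0.
have [/existsP[d /andP[dA touch]]|/existsPn noT] := boolP [exists d, (d \notin A) &&
   ((source d \in (@source R) @: A) || (face_of d \in (@face_of R) @: A))].
  apply: (corner_euler_remove dA touch); apply: IHn.
    rewrite -ltnS; apply: leq_trans ltn; rewrite ltnS; apply: proper_card.
    by rewrite properC properEneq subsetUr andbT; apply: contraNneq dA => ->; rewrite setU11.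
  by apply/set0Pn; exists d; rewrite setU11.
case/eqP: AT; have in_A x : (source x \in (@source R) @: A) || (face_of x \in (@face_of R) @: A) -> x \in A.
  by move=> tx; have := noT x; rewrite tx andbT negbK.
have srcA x y : x \in A -> source y = source x -> y \in A.
  by move=> xA yx; apply: in_A; rewrite yx imset_f.
apply: (source_closed_setT d0A srcA) => x xA.
have nA : next_on_face x \in A by apply: in_A; rewrite face_of_next (imset_f _ xA) orbT.
exact: srcA nA (esym (source_next x)).
Qed.

End CornerEuler.

(** * Faces of 3-connected plane graphs *)

Section ThreeConnected.

Variable R : plane_graph.
Hypotheses (simpleR : simple_graph R) (connR : k_connected R 3).
Implicit Types (d : dart R) (A : {set dart R}).

Lemma connected_minus2 (S : {set vertex R}) (P : pred (vertex R)) : #|S| <= 2 ->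
  (forall d, source d \notin S -> target d \notin S -> P (source d) -> P (target d)) ->
  forall u v, u \notin S -> v \notin S -> P u -> P v.
Proof.
move=> S2 PS u v uS vS.
apply: connect_invariant (connR.2 S S2 u v uS vS) => x y.
by case/and3P=> xS yS /existsP[d /andP[/eqP dx /eqP dy]]; rewrite -dx -dy in xS yS *; apply: PS.
Qed.

Lemma exists_outside3 (S : {set vertex R}) : #|S| <= 3 -> exists v, v \notin S.
Proof.
move=> S3; have: ~~ ([set: vertex R] \subset S).
  by apply/negP => /subset_leq_card; rewrite cardsT => /leq_trans/(_ S3); rewrite leqNgt connR.1.
by case/subsetPn=> v _ vS; exists v.
Qed.

(** At most two neighbours of [v] would separate [v] from a fourth vertex. *)
Lemma degree_ge3 (v : vertex R) : 3 <= degree v.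
Proof.
rewrite leqNgt ltnS; apply/negP => deg2; pose N := (@target R) @: [set d | source d == v].
have N2 : #|N| <= 2 by apply: leq_trans (leq_imset_card _ _) deg2.
have vN : v \notin N.
  apply/imsetP=> -[d]; rewrite inE => /eqP dv vt.
  by have := target_neq_source d; rewrite dv -vt eqxx.
have [u] : exists u, u \notin v |: N.
  by apply: exists_outside3; rewrite cardsU1 vN.
rewrite in_setU1 negb_or => /andP[uv uN]; case/negP: uv.
apply: (connected_minus2 (P := pred1 v) N2 _ vN uN) => //= d _ tN /eqP dv.
by case/negP: tN; apply: imset_f; rewrite inE dv.
Qed.

Lemma dart_avoiding d1 d2 (v : vertex R) : exists d, [/\ source d = v, d != d1 & d != d2].
Proof.
have: ~~ ([set d | source d == v] \subset [set d1; d2]).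
  apply/negP => /subset_leq_card; rewrite cards2 => le2.
  by have := leq_trans (degree_ge3 v) le2; case: (_ != _).
by case/subsetPn=> d; rewrite !inE negb_or => /eqP dv /andP[]; exists d.
Qed.

Lemma rotation_neq d : rotation d != d.
Proof.
apply/eqP => rd; have [d' [sd' d'd _]] := dart_avoiding d d (source d).
case/negP: d'd; move/esym/eqP: sd'; rewrite -rotation_orbit => /iter_findex <-.
by rewrite iter_fix.
Qed.

Lemma corner_connect_outside (S : {set vertex R}) A : #|S| <= 2 ->
  (forall x, x \in A -> source x \in S) ->
  forall d d', source d \notin S -> source d' \notin S -> connect (corner_rel A) d d'.
Proof.
move=> S2 AS d d' dS d'S.
have around x y : source x \notin S -> source y = source x -> connect (corner_rel A) x y.
  move=> xS; apply: connect_around_vertex => z zA zx.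
  by case/negP: xS; rewrite -zx AS.
pose P v := [forall y, (source y == v) ==> connect (corner_rel A) d y].
suff /forall_inP : P (source d') by apply.
apply: (connected_minus2 S2 _ dS d'S) => [x xS tS /forall_inP Px|].
  apply/forall_inP => y /eqP yt; apply: connect_trans (Px x (eqxx _)) _.
  apply: connect_trans (connect1 (corner_rel_opposite A x)) _.
  by apply: around.
by apply/forall_inP => y /eqP; apply: around.
Qed.

(** Outside [S] no corner interrupts the gluing and [R] stays connected. A dart with one end outside
    joins through its opposite, so only darts inside [S] need the extra hypothesis. *)
Lemma corner_connect_all (S : {set vertex R}) A : #|S| <= 2 ->
  (forall x, x \in A -> source x \in S) ->
  (forall d, source d \in S -> target d \in S ->
     exists2 x, source x \notin S & connect (corner_rel A) d x) ->
  forall d d', connect (corner_rel A) d d'.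
Proof.
move=> S2 AS inS; have cs := sym_connect_sym (corner_rel_sym A).
have out d : exists2 x, source x \notin S & connect (corner_rel A) d x.
  have [dS|dS] := boolP (source d \in S); last by exists d; rewrite ?connect0.
  have [tS|tS] := boolP (target d \in S); first exact: inS.
  by exists (opposite d) => //; apply/connect1/corner_rel_opposite.
move=> d d'; have [x xS dx] := out d; have [y yS d'y] := out d'.
apply: connect_trans dx (connect_trans (corner_connect_outside S2 AS xS yS) _).
by rewrite cs.
Qed.

(** If a face met a vertex at two corners, these would form a graph with two edges and two nodes,
    which needs two faces by Euler's inequality. But deleting that one vertex leaves [R] connected,
    so there is only one class. *)
Lemma face_simple d1 d2 : face_of d1 = face_of d2 -> source d1 = source d2 -> d1 = d2.
Proof.
move=> f12 s12; apply/eqP/negPn/negP => d12; pose A := [set d1; d2].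
have: corner_euler A by apply: corner_eulerP; apply/set0Pn; exists d1; rewrite !inE eqxx.
rewrite /corner_euler !imsetU1 !imset_set1 f12 s12 !setUid !cards1 cards2 d12.
suff: #|classes (corner_rel A)| <= 1 by lia.
apply/card_classes_connect/(corner_connect_all (S := [set source d2])).
- by rewrite cards1.
- by move=> x; rewrite !inE => /orP[]/eqP->; rewrite ?s12.
- move=> d; rewrite !inE => /eqP ds /eqP dt.
  by have := target_neq_source d; rewrite ds dt eqxx.
Qed.

(** Otherwise [d] and [rotation d] would be two corners of one face at the same vertex. *)
Lemma face_of_opposite_neq d : face_of (opposite d) != face_of d.
Proof.
rewrite -face_of_rotation; apply/eqP => fd; have := rotation_neq d.
by rewrite (face_simple fd (source_rotation d)) eqxx.
Qed.

Lemma corner_connect_around2 A d d' :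
  (forall x, x \in A -> source x = source d -> x = d \/ x = rotation d) ->
  source d' = source d -> d' != d -> connect (corner_rel A) (rotation d) d'.
Proof.
move=> Ad sd' d'd; have: fconnect (@rotation R) (rotation d) d'.
  by rewrite rotation_orbit source_rotation sd'.
move/iter_findex; move: (findex _ _ _) => n nE.
suff [dE|] : iter n (@rotation R) (rotation d) = d \/
    connect (corner_rel A) (rotation d) (iter n (@rotation R) (rotation d)).
- by rewrite -nE dE eqxx in d'd.
- by rewrite nE.
elim: {d' sd' d'd nE} n => [|n]; first by right.
rewrite iterS; set y := iter n _ _ => -[->|IHn]; first by right; apply: connect0.
have sy : source (rotation y) = source d.
  rewrite source_rotation /y; elim: (n) => [|m IHm] /=; first by rewrite source_rotation.
  by rewrite source_rotation.
have [yA|yA] := boolP (rotation y \in A).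
  by case: (Ad _ yA sy) => ->; [left|right; apply: connect0].
by right; apply: connect_trans IHn (connect1 (corner_rel_rotation yA)).
Qed.

(** Suppose two edges separate the same two faces. The corners on both sides of [d1] and [d2] at
    their sources give four edges on four nodes, so at least two classes. But 3-connectedness leaves
    a single class when the two sources are deleted. *)
Lemma dual_simple d1 d2 : face_of d1 = face_of d2 ->
  face_of (opposite d1) = face_of (opposite d2) -> d1 = d2.
Proof.
move=> f12 g12; apply/eqP/negPn/negP => d12.
have s12 : source d1 != source d2 by apply: contraNneq d12 => /(face_simple f12) ->.
pose A := [set d1; rotation d1] :|: [set d2; rotation d2].
have: corner_euler A by apply: corner_eulerP; apply/set0Pn; exists d1; rewrite !inE eqxx.
rewrite /corner_euler; have -> : (@source R) @: A = [set source d1; source d2].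
  by rewrite !imsetU !imset_set1 !source_rotation !setUid.
have -> : (@face_of R) @: A = [set face_of d1; face_of (opposite d1)].
  by rewrite !imsetU !imset_set1 !face_of_rotation f12 g12 setUid.
have -> : #|A| = 4.
  rewrite cardsU !cards2 ![_ == rotation _]eq_sym !rotation_neq /=.
  rewrite (_ : _ :&: _ = set0) ?cards0 //; apply/eqP; rewrite setI_eq0 disjoints_subset.
  apply/subsetP => x xd1; rewrite !inE; apply/negP => xd2; case/eqP: s12.
  have -> : source d1 = source x by move: xd1; rewrite !inE => /orP[]/eqP->; rewrite ?source_rotation.
  by case/orP: xd2 => /eqP->; rewrite ?source_rotation.
suff: #|classes (corner_rel A)| <= 1 by rewrite !cards2; case: (_ != _); case: (_ != _); lia.
have cs := sym_connect_sym (corner_rel_sym A).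
pose S := [set source d1; source d2].
have AS x : x \in A -> source x \in S.
  by rewrite !inE => /orP[]/orP[]/eqP->; rewrite ?source_rotation eqxx ?orbT.
(* Some third dart [x] at the same vertex is glued to [d]; by simplicity only one edge joins the two
   sources, so [x] leads out of [S]. *)
have key d0 d : (d0 = d1 \/ d0 = d2) -> source d = source d0 -> d != d0 -> target d \in S ->
    exists2 x, source x \notin S & connect (corner_rel A) d x.
  move=> d0E sd dd0 tS; have [x [sx xd0 xd]] := dart_avoiding d0 d (source d0).
  have Ad0 y : y \in A -> source y = source d0 -> y = d0 \/ y = rotation d0.
    rewrite !inE => yA ys; case: d0E => d0E; rewrite d0E in ys *;
      case/orP: yA ys => /orP[]/eqP-> ys; rewrite ?source_rotation in ys; auto;
      by rewrite ys eqxx in s12.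
  exists (opposite x); last first.
    apply: connect_trans (connect1 (corner_rel_opposite A x)).
    apply: connect_trans (corner_connect_around2 Ad0 sx xd0).
    by rewrite cs; apply: corner_connect_around2.
  have st y : source y = source d0 -> target y != source d0.
    by move=> <-; apply: target_neq_source.
  have other y : source y = source d0 -> target y \in S ->
      target y = if d0 == d1 then source d2 else source d1.
    move=> /st + /set2P; case: d0E => ->.
      by rewrite eqxx => /eqP yt [].
    by rewrite [d2 == d1]eq_sym (negPf d12) => /eqP yt [].
  apply/negP => xS; case/negP: xd; apply/eqP/simpleR; first by rewrite sx sd.
  by rewrite (other x) // (other d).
apply/card_classes_connect/(corner_connect_all (S := S)) => //.
  by rewrite cards2; case: (_ != _).
move=> d dS tS.
(* The dart [d0] itself is cut off at its source by the two corners beside it, so the argument moves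
   to its other end. *)
have flip d' d0 : (d0 = d1 \/ d0 = d2) -> opposite d1 != d2 -> opposite d2 != d1 ->
    d' = d0 -> target d' \in S -> exists2 x, source x \notin S & connect (corner_rel A) d' x.
  move=> d0E n12 n21 -> tS'.
  have [x xS ox] : exists2 x, source x \notin S & connect (corner_rel A) (opposite d0) x.
    have sS : source d0 \in S by case: d0E => ->; rewrite !inE eqxx ?orbT.
    rewrite !inE in tS'; case: d0E => d0E; rewrite d0E in tS' sS *.
      by apply: (key d2); rewrite ?target_opposite; auto;
        rewrite (negPf (target_neq_source d1)) in tS'; apply/eqP.
    by apply: (key d1); rewrite ?target_opposite; auto;
      rewrite (negPf (target_neq_source d2)) orbF in tS'; apply/eqP.
  by exists x => //; apply: connect_trans (connect1 (corner_rel_opposite A d0)) ox.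
have n12 : opposite d1 != d2.
  by apply/eqP => od; have := face_of_opposite_neq d1; rewrite od f12 eqxx.
have n21 : opposite d2 != d1.
  by apply/eqP => od; have := face_of_opposite_neq d2; rewrite od f12 eqxx.
move: dS; rewrite !inE => /orP[]/eqP ds.
  by have [dE|dd1] := eqVneq d d1; [apply: (flip _ d1); auto|apply: (key d1); auto].
by have [dE|dd2] := eqVneq d d2; [apply: (flip _ d2); auto|apply: (key d2); auto].
Qed.

End ThreeConnected.

(** * Greedy cyclic colouring of a 3-connected plane graph *)

Section Arithmetic.
Import Order.TTheory GRing.Theory Num.Theory.
Local Open Scope ring_scope.
Variable F : realFieldType.

(* Let [a >= m] be the two largest values of [x]. As [1/2 - 1/(n+2)] equals
   [n / (2(n+2))], the values other than [a] contribute at least their sum [s]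
   divided by [2(m+2)], so [s + j < m + 4] when [m > 0]. *)
Lemma excess_bound (L j : nat) (D : finType) (A : {set D}) (x : D -> nat) :
  (3 <= L)%N -> (forall d, d \in A -> (x d).+2 <= L)%N ->
  \sum_(d in A) (1 / 2 - 1 / (x d).+2%:R) + j%:R / 6 < 1 :> F ->
  (\sum_(d in A) x d + j < 2 * L)%N.
Proof.
move=> L3 xL; pose h (n : nat) : F := 1 / 2 - 1 / n.+2%:R.
have pos n : 0 < n.+2%:R :> F by rewrite ltr0n.
have hE n : h n = n%:R / (2 * n.+2%:R).
  rewrite /h; have := pos n; rewrite -addn2 natrD => /lt0r_neq0 n2.
  by field.
have h_ge m n : (n <= m)%N -> n%:R / (2 * m.+2%:R) <= h n.
  move=> nm; rewrite hE ler_wpM2l ?ler0n // lef_pV2 ?posrE ?mulr_gt0 //.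
  by rewrite ler_pM2l // ler_nat.
have h_mono m n : (n <= m)%N -> h n <= h m.
  by move=> nm; rewrite /h lerD2l lerN2 !div1r lef_pV2 ?posrE // ler_nat.
have j_lt n : j%:R < n%:R :> F -> (j < n)%N by rewrite ltr_nat.
have clear_denom (M p q : F) : 0 < M -> p / (2 * M) + q / 6 < 1 -> 3 * p + q * M < 6 * M.
  move=> M_gt0; have M6 : 0 < 6 * M by rewrite mulr_gt0.
  rewrite -(ltr_pM2r M6) mul1r mulrDl.
  have -> : p / (2 * M) * (6 * M) = 3 * p by have := lt0r_neq0 M_gt0 => M0; field.
  have -> // : q / 6 * (6 * M) = q * M by field.
have [->|A0] := eqVneq A set0.
  by rewrite !big_set0 add0r => jlt; have /j_lt : j%:R < 6%:R :> F; [lra | lia].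
have [|a aA aE] := @eq_bigmax_cond _ [in A] x; first by rewrite card_gt0.
rewrite !(big_setD1 a aA) /=.
set m := \max_(d in A :\ a) x d; set s := (\sum_(d in A :\ a) x d)%N.
have xm d : d \in A :\ a -> (x d <= m)%N by move=> dA; rewrite /m; apply: leq_bigmax_cond.
have mxa : (m <= x a)%N.
  by apply/bigmax_leqP => d; rewrite !inE => /andP[_ dA]; rewrite -aE; apply: leq_bigmax_cond.
have hs : s%:R / (2 * m.+2%:R) <= \sum_(d in A :\ a) (1 / 2 - 1 / (x d).+2%:R) :> F.
  rewrite /s natr_sum mulr_suml; by apply: ler_sum => d dA; apply/h_ge/xm.
move=> lt1; have := xL a aA => xaL.
have lt1' : s%:R / (2 * m.+2%:R) + h (x a) + j%:R / 6 < 1.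
  by apply: le_lt_trans lt1; rewrite lerD2r [leRHS]addrC lerD2r.
(* If [m] is 0, all values but [x a] vanish. Then [j <= 5] if [x a] is 0 too, and [j <= 4]
   otherwise; both suffice since [x a <= L - 2] and [3 <= L]. *)
have [m0|m_gt0] := posnP m.
  have s0 : s = 0%N.
    apply/eqP; rewrite sum_nat_eq0; apply/forall_inP => d dA.
    by rewrite -leqn0 -m0 xm.
  move: lt1'; rewrite s0 mul0r add0r addn0 => lt1'.
  have [xa0|xa1] := posnP (x a).
    have h0 : h 0%N = 0 by rewrite hE mul0r.
    have /j_lt : j%:R < 6%:R :> F by rewrite xa0 h0 in lt1'; lra.
    lia.
  have h1 : h 1%N = 1 / 6 by rewrite hE mul1r; field.
  have := h_mono _ _ xa1; rewrite h1 => h1x.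
  have /j_lt : j%:R < 5%:R :> F by lra.
  lia.
have hm := h_mono _ _ mxa; rewrite hE in hm.
have := lt1'; have mp := pos m.
have {}lt1' : (3 * (m + s) + j * m.+2)%N%:R < (6 * m.+2)%N%:R :> F.
  have lt2 : (m%:R + s%:R) / (2 * m.+2%:R) + j%:R / 6 < 1 :> F.
    by apply: le_lt_trans lt1'; rewrite lerD2r addrC mulrDl lerD2l.
  by rewrite [in ltLHS]natrD 3!natrM [(m + s)%N%:R]natrD; apply: clear_denom.
rewrite ltr_nat in lt1'; move=> _.
have : (3 * j <= j * m.+2)%N by rewrite mulnC leq_mul2l; lia.
lia.
Qed.

(** Each fibre of [f] in [A] has total weight 1. *)
Lemma card_imset_sum (T U : finType) (f : T -> U) (A : {set T}) :
  \sum_(x in A) 1 / #|[set y in A | f y == f x]|%:R = #|f @: A|%:R :> F.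
Proof.
rewrite (partition_big_imset f) /= -sum1_card natr_sum; apply: eq_bigr => _ /imsetP[x xA ->].
rewrite (eq_bigr (fun=> 1 / #|[set y in A | f y == f x]|%:R)); last first.
  by move=> y /andP[_ /eqP->].
rewrite (eq_bigl [in [set y in A | f y == f x]]) => [|y]; last by rewrite !inE.
rewrite sumr_const -[LHS]mulr_natr divfK // pnatr_eq0 -lt0n card_gt0.
by apply/set0Pn; exists x; rewrite !inE xA eqxx.
Qed.


Lemma sum_gt0_exists (T : finType) (A : {set T}) (g : T -> F) :
  0 < \sum_(x in A) g x -> exists2 x, x \in A & 0 < g x.
Proof.
move=> sum_gt0; have [/exists_inP[x]|/exists_inPn noF] := boolP [exists x in A, 0 < g x].
  by exists x.
suff : \sum_(x in A) g x <= 0 by rewrite leNgt sum_gt0.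
by apply: sumr_le0 => x /noF; rewrite -leNgt.
Qed.

End Arithmetic.

Section FaceConflicts.

Variable G : rotation_graph.

Definition share_face (u v : vertex G) : bool :=
  [exists d : dart G, (u \in face_vertices (face_of d)) && (v \in face_vertices (face_of d))].

Definition max_face_length : nat := \max_(d : dart G) #|face_of d|.

Lemma face_verticesP (d : dart G) u :
  reflect (exists2 d', source d' = u & face_of d' = face_of d)
          (u \in face_vertices (face_of d)).
Proof.
apply: (iffP imsetP) => [[d' + ->]|[d' <- fd']].
  by rewrite mem_face_of => /eqP; exists d'.
by exists d' => //; rewrite mem_face_of fd'.
Qed.

Lemma source_face (d : dart G) : source d \in face_vertices (face_of d).
Proof. by apply/face_verticesP; exists d. Qed.

Lemma target_face (d : dart G) : target d \in face_vertices (face_of d).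
Proof. by apply/face_verticesP; exists (next_on_face d); rewrite ?source_next ?face_of_next. Qed.

Lemma target_face_rotation (d : dart G) : target d \in face_vertices (face_of (rotation d)).
Proof. by rewrite face_of_rotation; apply: source_face. Qed.

End FaceConflicts.

(** * The bipartite graph of incidences of a vertex set *)

Section Degeneracy.

Variable R : plane_graph.
Hypotheses (simpleR : simple_graph R) (connR : k_connected R 3).
Local Notation L := (max_face_length R).

Lemma card_face_vertices (d : dart R) : #|face_vertices (face_of d)| = #|face_of d|.
Proof.
apply: card_in_imset => x y; rewrite !mem_face_of => /eqP fx /eqP fy.
by apply: (face_simple connR); rewrite fx fy.
Qed.

Lemma face_length_le (d : dart R) : #|face_of d| <= L.
Proof. exact: leq_bigmax. Qed.

(** A face of length two would, by simplicity, run along one edge and back, making a dart fixed by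
    [rotation]. *)
Lemma face_length_ge3 (d : dart R) : 3 <= #|face_of d|.
Proof.
pose n := @next_on_face R.
have nd : n d != d.
  apply/eqP => nd; have := target_neq_source d.
  by rewrite -source_next -/n nd eqxx.
have nnd : n (n d) != d.
  apply/eqP => nnd; have od : n d = opposite d.
    apply: simpleR; first exact: source_next.
    by rewrite target_opposite -(source_next (n d)) -/n nnd.
  by have := rotation_neq connR (opposite d); rewrite -/(next_on_face d) -/n od eqxx.
have nn : n (n d) != n d by rewrite (inj_eq (@next_on_face_inj R)).
have <- : #|[set d; n d; n (n d)]| = 3.
  by rewrite setUC cardsU1 cards2 !inE negb_or [d == _]eq_sym nd nnd nn.
apply/subset_leq_card/subsetP => x; rewrite !inE -!orbA => /or3P[]/eqP->.
- exact: connect0.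
- exact: fconnect1.
- exact: connect_trans (fconnect1 _ _) (fconnect1 _ _).
Qed.

Section Subset.

Variable S : {set vertex R}.
Hypothesis S3 : 2 < #|S|.

Definition weight (d : dart R) : nat := #|face_vertices (face_of d) :&: S|.
(** The edges of the bipartite graph between [S] and the faces that contain at least two vertices of
    [S]. *)
Definition conflict_corners : {set dart R} := [set d | (source d \in S) && (1 < weight d)].
Local Notation A := conflict_corners.

Hypothesis S_corner : forall s, s \in S -> exists2 d, d \in A & source d = s.

(** This is the degree of the face as a node of the bipartite graph: by [face_simple] a face has one
    corner at each of its vertices. *)
Lemma weight_corners d : d \in A -> weight d = #|[set y in A | face_of y == face_of d]|.
Proof.
rewrite inE => /andP[dS wd]; rewrite -(card_in_imset (f := @source R)).
  apply: eq_card => u; rewrite inE; apply/andP/imsetP => [[/face_verticesP[y <- fy] yS]|[y + ->]].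
    by exists y => //; rewrite !inE yS /weight fy eqxx andbT.
  rewrite !inE => /andP[/andP[yS _] /eqP <-]; split=> //; exact: source_face.
move=> x y; rewrite !inE => /andP[_ /eqP fx] /andP[_ /eqP fy].
by apply: (face_simple connR); rewrite fx fy.
Qed.

Lemma corner_both_ends d : source d \in S -> target d \in S -> (d \in A) && (rotation d \in A).
Proof.
move=> sS tS; rewrite !inE source_rotation sS /=.
have two f : source d \in face_vertices f -> target d \in face_vertices f ->
    1 < #|face_vertices f :&: S|.
  move=> sf tf; apply: leq_trans (_ : #|[set target d; source d]| <= _).
    by rewrite cards2 target_neq_source.
  by apply/subset_leq_card/subsetP => u; rewrite !inE => /orP[]/eqP->; rewrite ?sf ?tf.
rewrite /weight !two ?source_face ?target_face ?target_face_rotation //.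
by rewrite -(source_rotation d) source_face.
Qed.

Lemma corner_opposite d : source d \in S -> target d \in S -> opposite d \in A.
Proof.
move=> sS tS; rewrite -target_opposite in sS.
by have /andP[] := corner_both_ends tS sS.
Qed.

Lemma class_meets_corner x s : s \in S -> source x = s ->
  exists2 d, d \in A & source d = s /\ connect (corner_rel A) x d.
Proof.
move=> sS xs; have [a aA sa] := S_corner sS.
have: fconnect (@rotation R) a x by rewrite rotation_orbit sa xs.
move/iter_findex; move: (findex _ _ _) => n.
elim: n x xs => [|n IHn] x xs /=; first by move=> <-; exists a.
move=> xE; have [xA|xA] := boolP (x \in A); first by exists x.
set y := iter n _ a in xE.
have [|d dA [sd yd]] := IHn y _ erefl; first by rewrite -(source_rotation y) xE.
exists d => //; split=> //; apply: connect_trans yd; apply: connect1.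
by rewrite corner_rel_sym -xE; apply: corner_rel_rotation; rewrite xE.
Qed.

(** If the corners of the class lay at no more than two vertices, 3-connectedness would spread the
    class over all darts leaving other vertices. As [S] has a third vertex, which carries a corner,
    that corner would belong to the class too. *)
Lemma class_three_corners x : source x \notin S ->
  2 < #|[set d in A | connect (corner_rel A) x d]|.
Proof.
move=> xS; apply: leq_trans (leq_imset_card (@source R) _).
set At := _ @: _; rewrite ltnNge; apply/negP => At2.
have AtS : At \subset S.
  by apply/subsetP => _ /imsetP[d + ->]; rewrite !inE => /andP[/andP[]].
have attach d : connect (corner_rel A) x d -> source d \in S -> source d \in At.
  move=> xd dS; have [y yA [<- dy]] := class_meets_corner dS erefl.
  by apply: imset_f; rewrite inE yA (connect_trans xd dy).
pose P v := [forall d, (source d == v) ==> connect (corner_rel A) x d].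
have xAt : source x \notin At by apply: contra xS; apply: (subsetP AtS).
have around y z : source y \notin S -> source z = source y -> connect (corner_rel A) y z.
  move=> yS; apply: connect_around_vertex => w wA wy.
  by case/negP: yS; rewrite -wy; move: wA; rewrite inE => /andP[].
have PT v : v \notin At -> P v.
  move=> vAt; apply: (connected_minus2 connR At2 _ xAt vAt) => [d dAt tAt /forall_inP Pd|].
    have xod : connect (corner_rel A) x (opposite d).
      exact: connect_trans (Pd d (eqxx _)) (connect1 (corner_rel_opposite A d)).
    apply/forall_inP => y /eqP yt; apply: (connect_trans xod).
    apply: around; last exact: yt.
    by apply: contra tAt => /(attach _ xod).
  by apply/forall_inP => y /eqP; apply: around.
have /subsetPn[s sS sAt] : ~~ (S \subset At).
  by apply/negP => /subset_leq_card; rewrite leqNgt (leq_ltn_trans At2 S3).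
have [a aA sa] := S_corner sS; case/negP: (sAt); rewrite -sa; apply: attach.
  by have /forall_inP := PT _ sAt; apply; rewrite sa.
by rewrite sa.
Qed.

End Subset.
End Degeneracy.

(** * Discharging by curvature *)

Section Curvature.

Import Order.TTheory GRing.Theory Num.Theory.

Variable F : realFieldType.
Variable R : plane_graph.
Hypotheses (simpleR : simple_graph R) (connR : k_connected R 3).
Variable S : {set vertex R}.
Hypothesis S3 : 2 < #|S|.
Local Notation L := (max_face_length R).
Local Notation A := (conflict_corners S).
Hypothesis S_corner : forall s, s \in S -> exists2 d, d \in A & source d = s.

Definition face_conflicts (s : vertex R) : {set vertex R} :=
  [set u in S | (u != s) && share_face s u].

Definition free_corners s : {set dart R} :=
  [set d in A | (source d == s) && (target d \notin S)].

(** Each class receives at least 1 from its corners. A class with a dart starting outside [S] has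
    three corners worth at least 1/3 each; any other class contains both darts of an edge inside
    [S], two corners worth 1/2 each. *)
Lemma card_classes_le : (#|classes (corner_rel A)|%:R <=
  \sum_(d in A) (if target d \in S then 1 / 2 else 1 / 3) :> F)%R.
Proof.
have csym := sym_connect_sym (corner_rel_sym A).
rewrite (partition_big (class_of (corner_rel A)) (mem (classes (corner_rel A)))) /=; last first.
  by move=> d _; apply: imset_f.
rewrite -sum1_card natr_sum; apply: ler_sum => _ /imsetP[x _ ->].
pose B := [set d in A | connect (corner_rel A) x d].
rewrite (eq_bigl [in B]) => [|d]; last first.
  by rewrite !inE (eq_class_of _ _ (corner_rel_sym A)) csym.
have const (c : F) n : (forall d, d \in B -> c <= if target d \in S then 1 / 2 else 1 / 3)%R ->
    (n <= #|B|)%N -> (0 <= c)%R -> (c *+ n <= \sum_(d in B) if target d \in S then 1 / 2 else 1 / 3)%R.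
  move=> cB nB c0; apply: le_trans (_ : (c *+ #|B| <= _)%R).
    by rewrite -(subnK nB) mulrnDr lerDr mulrn_wge0.
  by rewrite -sumr_const; apply: ler_sum.
have [/existsP[y /andP[xy yS]]|/existsPn inS] :=
    boolP [exists y, connect (corner_rel A) x y && (source y \notin S)].
  have B3 : 2 < #|B|.
    have -> : B = [set d in A | connect (corner_rel A) y d].
      by apply/setP => d; rewrite !inE (same_connect csym xy).
    exact: class_three_corners.
  apply: le_trans (const (1 / 3)%R 3 _ B3 _).
  - by lra.
  - by move=> d _; case: ifP => _; lra.
  - by lra.
have sS y : connect (corner_rel A) x y -> source y \in S.
  by move=> xy; have := inS y; rewrite xy /= negbK.
have xo := connect1 (corner_rel_opposite A x).
have [sx tx] := (sS x (connect0 _ _), sS _ xo).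
apply: le_trans (const (1 / 2)%R 2 _ _ _); try lra.
  move=> d; rewrite inE => /andP[_ xd]; rewrite ifT //.
  exact: sS (connect_trans xd (connect1 (corner_rel_opposite A d))).
have <- : #|[set opposite x; x]| = 2 by rewrite cards2 opposite_neq.
apply/subset_leq_card/subsetP => d /set2P[]->; rewrite inE ?connect0 ?xo ?andbT.
  exact: corner_opposite.
by case/andP: (corner_both_ends sx tx).
Qed.

(** Give each vertex of [S] charge 1 and each corner [1 / weight] for its face, its share of a
    class, and -1 as an edge. By Euler's inequality the total is at least 2, so some vertex is
    positive. The 1/6 is 1/2 - 1/3, the loss at a corner whose dart leaves [S]. *)
Lemma exists_positive_curvature : exists2 s, s \in S &
  (\sum_(d in A | source d == s) (1 / 2 - 1 / (weight S d)%:R)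
     + #|free_corners s|%:R / 6 < 1 :> F)%R.
Proof.
have srcA : (@source R) @: A = S.
  apply/setP => s; apply/imsetP/idP => [[d + ->]|/S_corner[d dA <-]]; last by exists d.
  by rewrite inE => /andP[].
have /corner_eulerP : A != set0.
  have /card_gt0P[s /S_corner[d dA _]] := ltn_trans (ltn0Sn 1) S3.
  by apply/set0Pn; exists d.
rewrite /corner_euler srcA => eul.
pose w (d : dart R) : F := (if target d \in S then 1 / 2 else 1 / 3)%R.
pose g (d : dart R) : F := (1 / (weight S d)%:R + w d - 1)%R.
have [|s sS gs] := @sum_gt0_exists F _ S (fun s => 1 + \sum_(d in A | source d == s) g d)%R.
  rewrite big_split /= sumr_const.
  rewrite -(partition_big (@source R) [in S]) /=; last by move=> d; rewrite inE => /andP[].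
  rewrite big_split /= big_split /= sumrN sumr_const.
  have -> : (\sum_(d in A) 1 / (weight S d)%:R = #|(@face_of R) @: A|%:R :> F)%R.
    by rewrite -card_imset_sum; apply: eq_bigr => d /weight_corners ->.
  have clA := card_classes_le.
  have : ((#|A| + 2)%N%:R <= (#|S| + #|(@face_of R) @: A| + #|classes (corner_rel A)|)%N%:R :> F)%R.
    by rewrite ler_nat.
  rewrite !natrD -/w; lra.
exists s => //; move: gs; rewrite addrC -subr_gt0 => gs.
suff E : (\sum_(d in A | source d == s) g d =
   - (\sum_(d in A | source d == s) (1 / 2 - 1 / (weight S d)%:R) + #|free_corners s|%:R / 6))%R.
  by rewrite E in gs; lra.
have -> : (#|free_corners s|%:R / 6 = \sum_(d in A | source d == s) (if target d \in S then 0 else 1 / 6) :> F)%R.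
  rewrite (bigID (fun d => target d \in S)) /= big1 ?add0r => [|d /andP[_ ->]//].
  rewrite (eq_bigr (fun=> 1 / 6)%R) => [|d /andP[_ /negPf->]//].
  rewrite (eq_bigl [in free_corners s]) => [|d]; last by rewrite !inE -!andbA.
  by rewrite sumr_const -[RHS]mulr_natr mulrC div1r.
rewrite -big_split -sumrN; apply: eq_bigr => d _; rewrite /g /w /=.
by case: ifP => _; lra.
Qed.

End Curvature.

Lemma card_bigcup_le (T U : finType) (A : {set T}) (g : T -> {set U}) :
  #|\bigcup_(x in A) g x| <= \sum_(x in A) #|g x|.
Proof.
elim/big_rec2: _ => [|x m X _ IH]; first by rewrite cards0.
by apply: leq_trans (leq_card_setU _ _).1 _; rewrite leq_add2l.
Qed.

(** * Degeneracy and the greedy colouring *)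

Section VertexColoring.

Variable R : plane_graph.
Hypotheses (simpleR : simple_graph R) (connR : k_connected R 3).
Local Notation L := (max_face_length R).

(** At the corner [d], skip [s] and the end of the preceding dart [pr d], which also lies on this
    face. If in [S], that neighbour is counted on the face of [pr d], where it is not skipped. So
    [d] contributes [weight - 2], plus 1 if the neighbour is outside [S]. *)
Lemma card_face_conflicts (S : {set vertex R}) s : s \in S ->
  #|face_conflicts S s| <=
    \sum_(d in conflict_corners S | source d == s) (weight S d - 2) + #|free_corners S s|.
Proof.
move=> sS; set A := conflict_corners S.
pose pr := finv (@rotation R).
have rK : cancel pr (@rotation R) := f_finv (@rotation_inj R).
have Kr : cancel (@rotation R) pr := finv_f (@rotation_inj R).
have s_pr d : source (pr d) = source d by rewrite -[in RHS](rK d) source_rotation.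
pose As := [set d in A | source d == s].
pose g d := (face_vertices (face_of d) :&: S) :\ s :\ target (pr d).
have cover_conf : face_conflicts S s \subset \bigcup_(d in As) g d.
  apply/subsetP => u; rewrite inE => /and3P[uS us /existsP[d0 /andP[]]].
  move=> /face_verticesP[d sd fd]; rewrite -fd => uf.
  have in_As x : source x = s -> u \in face_vertices (face_of x) -> x \in As.
    move=> xs ux; rewrite !inE xs sS eqxx andbT /=.
    apply: leq_trans (_ : #|[set u; s]| <= _); first by rewrite cards2 us.
    apply/subset_leq_card/subsetP => v /set2P[]->; rewrite inE ?ux ?uS ?sS //.
    by rewrite -xs source_face.
  have [ut|ut] := eqVneq u (target (pr d)); apply/bigcupP; last first.
    by exists d; rewrite ?in_As // !inE us uS uf ut.
  have spd : source (pr d) = s by rewrite s_pr.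
  have upd : u \in face_vertices (face_of (pr d)) by rewrite ut target_face.
  exists (pr d); first exact: in_As.
  rewrite !inE us uS upd !andbT; apply/eqP => utt.
  have: pr (pr d) = pr d by apply: simpleR; rewrite ?s_pr // -utt.
  by move/(congr1 (@rotation R)); rewrite !rK => /(congr1 (@rotation R));
     rewrite rK => rd; have := rotation_neq connR d; rewrite -rd eqxx.
apply: leq_trans (subset_leq_card cover_conf) _.
apply: leq_trans (card_bigcup_le _ _) _.
have le_g d : d \in As -> #|g d| <= (weight S d - 2) + (target (pr d) \notin S).
  rewrite !inE => /andP[/andP[dS wd] /eqP ds].
  have sf : s \in face_vertices (face_of d) :&: S by rewrite inE sS -ds source_face.
  have := cardsD1 s (face_vertices (face_of d) :&: S); rewrite sf -/(weight S d).
  have := cardsD1 (target (pr d)) ((face_vertices (face_of d) :&: S) :\ s).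
  rewrite -/(g d) !inE.
  have -> : target (pr d) != s by rewrite -ds -s_pr target_neq_source.
  have -> : target (pr d) \in face_vertices (face_of d).
    by rewrite -[in face_of d](rK d) target_face_rotation.
  by case: (target (pr d) \in S) => /=; lia.
apply: (@leq_trans (\sum_(d in As) ((weight S d - 2) + (target (pr d) \notin S)))).
  exact: leq_sum.
rewrite big_split /=.
have AsE d : (d \in As) = (d \in A) && (source d == s) by rewrite inE.
rewrite (eq_bigl _ _ AsE) leq_add2l.
pose B1 := [set d in As | target d \in S]; pose B2 := [set d in As | target (pr d) \in S].
(* [rotation] takes a corner whose dart ends in [S] to a corner whose preceding dart ends in [S]. *)
have le12 : #|B1| <= #|B2|.
  rewrite -(card_imset _ (@rotation_inj R)); apply/subset_leq_card/subsetP.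
  move=> _ /imsetP[d + ->]; rewrite !inE Kr source_rotation => /andP[/andP[/andP[dS _] ->] tS].
  rewrite tS dS !andbT /=; have /andP[_] := corner_both_ends dS tS.
  by rewrite inE source_rotation dS.
have -> : \sum_(d in As) (target (pr d) \notin S) = #|As| - #|B2|.
  rewrite -(cardsID B2 As) (setIidPr _); last by apply/subsetP => d; rewrite inE => /andP[].
  rewrite addKn -sum1_card big_mkcond [RHS]big_mkcond /=; apply: eq_bigr => d _.
  by rewrite !inE; case: (_ && (source d == s)); case: (target _ \in S).
have -> : free_corners S s = As :\: B1.
  apply/setP => d; rewrite !inE; case: (target d \in S); case: (source d == s);
    by case: (source d \in S); case: (1 < weight S d).
rewrite cardsD (setIidPr _); last by apply/subsetP => d; rewrite inE => /andP[].
exact: leq_sub2l.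
Qed.

Lemma max_face_length_ge3 : 3 <= L.
Proof.
have [|v _] := exists_outside3 connR (S := set0); first by rewrite cards0.
have /card_gt0P[d _] := leq_trans (isT : 0 < 3) (degree_ge3 connR v).
exact: leq_trans (face_length_ge3 simpleR connR d) (face_length_le d).
Qed.

Lemma few_conflicts (S : {set vertex R}) : S != set0 ->
  exists2 s, s \in S & #|face_conflicts S s| < 2 * L.
Proof.
move=> /set0Pn[s0 s0S]; have L3 := max_face_length_ge3.
have [S2|S3] := leqP #|S| 2.
  exists s0 => //; have: face_conflicts S s0 \subset S :\ s0.
    by apply/subsetP => u; rewrite !inE => /and3P[-> ->].
  by move/subset_leq_card; have := cardsD1 s0 S; rewrite s0S; lia.
have [/exists_inP[s sS /exists_inPn noA]|/exists_inPn allA] :=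
    boolP [exists s in S, ~~ [exists d in conflict_corners S, source d == s]].
  exists s => //; rewrite (_ : face_conflicts S s = set0) ?cards0; first by lia.
  apply/setP => u; rewrite !inE; apply/negP => /and3P[uS us /existsP[d0 /andP[]]].
  move=> /face_verticesP[d sd fd]; rewrite -fd => uf.
  have /noA : d \in conflict_corners S; last by rewrite sd eqxx.
  rewrite inE sd sS; apply: leq_trans (_ : #|[set u; s]| <= _); first by rewrite cards2 us.
  apply/subset_leq_card/subsetP => v /set2P[]->; rewrite inE ?uf ?uS ?sS //.
  by rewrite -sd source_face.
have S_corner s : s \in S -> exists2 d, d \in conflict_corners S & source d = s.
  by move=> /allA; rewrite negbK => /exists_inP[d dA /eqP]; exists d.
have [s sS curv] := exists_positive_curvature rat connR S3 S_corner.
exists s => //; apply: leq_ltn_trans (card_face_conflicts sS) _.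
pose As := [set d in conflict_corners S | source d == s].
have AsE d : (d \in conflict_corners S) && (source d == s) = (d \in As) by rewrite [RHS]inE.
rewrite (eq_bigl _ _ AsE); rewrite (eq_bigl _ _ AsE) in curv.
(* [excess_bound] is applied with [x d] equal to [weight S d - 2]; no truncation occurs, as conflict
   corners have weight at least 2. *)
have wE d : d \in As -> (weight S d - 2).+2 = weight S d.
  by rewrite -AsE inE => /andP[/andP[_ wd] _]; lia.
apply: (excess_bound (F := rat) L3) => [d dA|].
  rewrite wE // (leq_trans _ (face_length_le d)) // -(card_face_vertices connR).
  exact/subset_leq_card/subsetIl.
by rewrite (eq_bigr _ (fun d dA => congr1 (fun n => 1 / 2 - 1 / n%:R)%R (wE d dA))).
Qed.

(** Set aside a vertex with few conflicts, colour the rest inductively, and give it a colour its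
    conflicts do not use. *)
Lemma cyclic_vertex_coloring :
  exists c : vertex R -> 'I_(2 * L), forall u v, share_face u v -> u != v -> c u != c v.
Proof.
have L3 := max_face_length_ge3.
suff [c cP] : exists c : vertex R -> 'I_(2 * L), {in [set: vertex R] &, forall u v,
    share_face u v -> u != v -> c u != c v}.
  by exists c => u v; apply: cP; rewrite inE.
have [n] := ubnP #|[set: vertex R]|; elim: n [set: _] => // n IHn S ltS.
have [->|S0] := eqVneq S set0.
  have L0 : 0 < 2 * L by lia.
  by exists (fun=> Ordinal L0) => u v; rewrite inE.
have [s sS few] := few_conflicts S0.
have [|c cP] := IHn (S :\ s); first by have := cardsD1 s S; rewrite sS; lia.
have /subsetPn[a _ aN] : ~~ ([set: 'I_(2 * L)] \subset c @: face_conflicts S s).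
  apply/negP => /subset_leq_card; rewrite cardsT card_ord leqNgt => /negP[].
  exact: leq_ltn_trans (leq_imset_card _ _) few.
have a_neq u : u \in S -> u != s -> share_face s u -> c u != a.
  by move=> uS us su; apply: contraNneq aN => <-; rewrite imset_f // inE uS us.
have sfC u v : share_face u v = share_face v u by apply: eq_existsb => d; rewrite andbC.
exists (fun u => if u == s then a else c u) => u v uS vS uv neq_uv.
case: (eqVneq u s) (eqVneq v s) => [us|us] [vs|vs].
- by rewrite us vs eqxx in neq_uv.
- by rewrite eq_sym a_neq // -us.
- by rewrite a_neq // -vs sfC.
- by apply: cP => //; rewrite !inE ?us ?vs.
Qed.


End VertexColoring.

(** * Colouring the subdivision *)

Lemma size_filter_notin (T : eqType) (s t : seq T) :
  uniq s -> size s - size t <= size [seq x <- s | x \notin t].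
Proof.
move=> us; rewrite size_filter -(count_predC (mem t) s) leq_subLR leq_add2r.
rewrite -size_filter; apply: uniq_leq_size; first exact: filter_uniq.
by move=> x; rewrite mem_filter => /andP[].
Qed.

(** * Colours for the vertices and edges of the base graph *)

Section BaseColoring.

Variable R : plane_graph.
Hypotheses (simpleR : simple_graph R) (connR : k_connected R 3).
Local Notation L := (max_face_length R).

(** Vizing's theorem for the dual graph, which has no loops by [face_of_opposite_neq], no multiple
    edges by [dual_simple], and maximum degree at most [L]. *)
Lemma dual_edge_coloring : exists c : dart R -> 'I_L.+1,
  (forall d, c (opposite d) = c d) /\
  (forall d d', face_of d = face_of d' -> c d = c d' -> d = d').
Proof.
pose e (F F' : {set dart R}) := [exists d, (face_of d == F) && (face_of (opposite d) == F')].
have e_dart d : e (face_of d) (face_of (opposite d)) by apply/existsP; exists d; rewrite !eqxx.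
have e_sym : symmetric e.
  suff sub F F' : e F F' -> e F' F by move=> F F'; apply/idP/idP; apply: sub.
  by case/existsP=> d /andP[/eqP <- /eqP <-]; have := e_dart (opposite d); rewrite oppositeK.
have e_irr : irreflexive e.
  move=> F; apply/existsP=> -[d /andP[/eqP <-]].
  exact/negP/face_of_opposite_neq.
have [|c [c_sym c_inj]] := vizing_edge_coloring (ord0 : 'I_L.+1) e_sym e_irr.
  move=> F; rewrite card_ord ltnS.
  have [->|/set0Pn[F']] := eqVneq [set F' | e F F'] set0; first by rewrite cards0.
  rewrite inE => /existsP[d0 /andP[/eqP d0F _]]; apply: leq_trans (face_length_le d0).
  apply: leq_trans (leq_imset_card (fun d => face_of (opposite d)) _).
  apply/subset_leq_card/subsetP => F1; rewrite inE => /existsP[d /andP[/eqP dF /eqP <-]].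
  by apply: imset_f; rewrite mem_face_of dF d0F.
exists (fun d => c (face_of d) (face_of (opposite d))); split=> [d|d d' fd cd].
  by rewrite oppositeK c_sym // e_sym.
apply: (dual_simple simpleR connR fd); apply: (c_inj (face_of d)); rewrite ?e_dart //.
  by rewrite fd e_dart.
by rewrite cd fd.
Qed.

Lemma opposite_faces_card (d : dart R) :
  #|face_vertices (face_of d) :|: face_vertices (face_of (opposite d))| < 2 * L.
Proof.
rewrite cardsU !(card_face_vertices connR).
have : 0 < #|face_vertices (face_of d) :&: face_vertices (face_of (opposite d))|.
  apply/card_gt0P; exists (source d); rewrite inE source_face.
  by rewrite -target_opposite target_face.
have := face_length_le d; have := face_length_le (opposite d).
have := max_face_length_ge3 simpleR connR; lia.
Qed.

Lemma vertex_edge_coloring k : 0 < k -> exists (cv : vertex R -> nat) (ce : dart R -> nat -> nat),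
  let N := (3 * (k.+1 * L)) %/ 2 in
  [/\ (forall v, cv v < N) /\ (forall d i, i < k -> ce d i < N),
      forall u v, share_face u v -> u != v -> cv u != cv v,
      forall d i, ce (opposite d) i = ce d i,
      forall d d' i j, face_of d = face_of d' -> i < k -> j < k ->
        ce d i = ce d' j -> d = d' /\ i = j
    & forall d v i, v \in face_vertices (face_of d) -> i < k -> cv v != ce d i].
Proof.
move=> k_gt0; have L3 := max_face_length_ge3 simpleR connR.
have [cv0 cv0P] := cyclic_vertex_coloring simpleR connR.
have [c [c_opp c_inj]] := dual_edge_coloring.
set N := (3 * (k.+1 * L)) %/ 2.
have N1 : k * L + 2 * L <= N by rewrite /N; nia.
(* Room above the first [k * L] colours for [2 * L - 1] vertex colours and [k] more: the slack
   before rounding is (k - 1)(L - 2)/2. *)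
have N2 : k * L + (2 * L - 1 + k) <= N.
  have : 2 * (k - 1) <= (k - 1) * L by rewrite mulnC leq_mul2l; lia.
  have : (k - 1) * L = k * L - L by rewrite mulnBl mul1n.
  have : L <= k * L by rewrite leq_pmull.
  by rewrite /N mulSn; lia.
pose cv v := k * L + cv0 v.
pose both (d : dart R) := face_vertices (face_of d) :|: face_vertices (face_of (opposite d)).
pose free d := [seq x <- iota (k * L) (N - k * L) | x \notin [seq cv v | v <- enum (both d)]].
have size_free d : k <= size (free d).
  apply: leq_trans (size_filter_notin _ (iota_uniq _ _)).
  by rewrite size_iota size_map -cardE; have := opposite_faces_card d; rewrite -/(both d); lia.
have free_uniq d : uniq (free d) by rewrite filter_uniq // iota_uniq.
have free_mem d i : i < k -> nth 0 (free d) i \in free d.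
  by move=> ik; apply: mem_nth; apply: leq_trans (size_free d).
have free_range d i : i < k -> k * L <= nth 0 (free d) i < N.
  by move=> /(free_mem d); rewrite mem_filter mem_iota => /andP[_]; lia.
(* Classes below [L] own disjoint blocks of [k] colours; the last class, numbered [L], uses colours
   absent from both faces at the edge. *)
pose ce d i := if c d < L then c d * k + i else nth 0 (free d) i.
have low d i : c d < L -> i < k -> c d * k + i < k * L by move=> cL ik; nia.
exists cv, ce; split.
- split=> [v|d i ik]; first by rewrite /cv; have := ltn_ord (cv0 v); lia.
  rewrite /ce; case: ifP => cL; first by have := low d i cL ik; lia.
  by case/andP: (free_range d i ik).
- by move=> u v uv neq; rewrite /cv eqn_add2l; apply: cv0P.
- move=> d i; rewrite /ce c_opp (_ : free (opposite d) = free d) //.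
  by rewrite /free /both oppositeK setUC.
- move=> d d' i j fd ik jk; rewrite /ce; case: ifP => cL; case: ifP => cL'.
  + move=> E; have cE : c d = c d' :> nat.
      by have := congr1 (divn^~ k) E; rewrite /= !divnMDl // !divn_small // !addn0.
    by have dE := c_inj _ _ fd (val_inj cE); split; rewrite // dE in E; lia.
  + by move=> E; have := low d i cL ik; have := free_range d' j jk; lia.
  + by move=> E; have := low d' j cL' jk; have := free_range d i ik; lia.
  + have cE : c d = c d' :> nat by have := ltn_ord (c d); have := ltn_ord (c d'); lia.
    have dE := c_inj _ _ fd (val_inj cE); rewrite dE => /eqP.
    by rewrite (nth_uniq 0 (leq_trans ik (size_free d')) (leq_trans jk (size_free d')) (free_uniq d')) => /eqP.
- move=> d v i vd ik; rewrite /ce; case: ifP => cL.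
    by have := low d i cL ik; rewrite /cv; lia.
  apply/eqP => E; have := free_mem d i ik; rewrite mem_filter -E => /andP[/negP nin _].
  by apply/nin/map_f; rewrite mem_enum inE vd.
Qed.

End BaseColoring.

(** * Faces and colours of the subdivision *)

Section Subdivision.

Variables (G R : plane_graph) (k : nat).
Variables (f : vertex R -> vertex G) (p : dart R -> 'I_k.+1 -> dart G).
Hypothesis sub : subdivides f p.
Implicit Types (d : dart R) (i j : 'I_k.+1).

Lemma sub_dart_inj d d' i j : p d i = p d' j -> d = d' /\ i = j.
Proof. by move/(bij_inj (sub_dart_bij sub) (x1 := (d, i)) (x2 := (d', j)))=> [-> ->]. Qed.

Lemma sub_dart_surj (x : dart G) : exists d i, x = p d i.
Proof. by have [g _ gK] := sub_dart_bij sub; exists (g x).1, (g x).2; rewrite gK. Qed.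

(** Only two darts leave an inner vertex of a path, and [rotation] must exchange them: a fixed dart
    would be alone in its orbit. *)
Lemma next_sub_inner d i j : j = i.+1 :> nat -> next_on_face (p d i) = p d j.
Proof.
move=> ji; set y := opposite (p d i).
have oE : y = p (opposite d) (rev_ord i) by apply: (sub_opposite sub).
have sE : source y = source (p d j) by rewrite -[LHS]/(target (p d i)) -(sub_step sub _ ji).
have j_gt0 : 0 < j by rewrite ji.
have at_y x : source x = source y -> x = y \/ x = p d j.
  have [d' [i' ->]] := sub_dart_surj x; rewrite sE => xs.
  have i'_gt0 : 0 < i'.
    rewrite lt0n; apply/eqP => i'0; have i'E : i' = ord0 by apply: val_inj.
    by case: (@sub_inner_new _ _ _ _ _ sub d j (source d') j_gt0); rewrite -xs i'E (sub_start sub).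
  case: (sub_inner_inj sub j_gt0 i'_gt0 (esym xs)) => [[-> ->]|[-> ij]]; [by right | left].
  by rewrite oE; congr p; apply: val_inj => /=; have := ltn_ord i; lia.
case: (at_y (rotation y)); rewrite ?source_rotation // => rot_y.
have: fconnect (@rotation G) y (p d j) by rewrite rotation_orbit sE.
move/iter_findex; rewrite iter_fix // oE => /sub_dart_inj[od _].
by have := opposite_neq d; rewrite od eqxx.
Qed.

Lemma next_sub_last d : next_on_face (p d ord_max) = p (next_on_face d) ord0.
Proof.
rewrite /next_on_face (sub_opposite sub) (_ : rev_ord ord_max = ord0) ?(sub_rotation sub) //.
by apply: val_inj; rewrite /= subnn.
Qed.

Lemma next_sub d i : exists d' j, next_on_face (p d i) = p d' j /\ face_of d' = face_of d.
Proof.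
have [ik|ki] := ltnP i k.
  by exists d, (inord i.+1); split=> //; apply: next_sub_inner; rewrite inordK.
exists (next_on_face d), ord0; split; last exact: face_of_next.
rewrite -next_sub_last; congr (next_on_face (p d _)); apply: val_inj => /=.
by have := ltn_ord i; lia.
Qed.

(** A walk along a face of [G] projects to a walk along a face of [R], possibly pausing on a
    dart. *)
Lemma face_of_sub d d' i j : face_of (p d i) = face_of (p d' j) -> face_of d = face_of d'.
Proof.
move/eqP; rewrite eq_face_of => /iter_findex; move: (findex _ _ _) => n.
elim: n d i => [|n IHn] d i; first by move/sub_dart_inj => [-> _].
rewrite iterSr; have [d1 [i1 [-> <-]]] := next_sub d i; exact: IHn.
Qed.

Lemma face_of_sub_path d i : face_of (p d i) = face_of (p d ord0).
Proof.
case: i => n; elim: n => [|n IHn] ltn; first by congr (face_of (p d _)); apply: val_inj.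
rewrite -(IHn (ltnW ltn)) -(next_sub_inner d (i := Ordinal (ltnW ltn))) //.
exact: face_of_next.
Qed.

Lemma sub_face d d' i j : face_of d = face_of d' -> face_of (p d i) = face_of (p d' j).
Proof.
rewrite !face_of_sub_path => /eqP; rewrite eq_face_of => /iter_findex <-.
elim: (findex _ _ _) => //= n ->.
by rewrite -next_sub_last face_of_next face_of_sub_path.
Qed.

Hypotheses (simpleR : simple_graph R) (connR : k_connected R 3).

Lemma sub_source_start d d' i : source (p d ord0) = source (p d' i) -> i = ord0.
Proof.
rewrite (sub_start sub) => fs; apply: val_inj; apply/eqP; rewrite -leqn0 leqNgt.
by apply/negP => i_gt0; case: (sub_inner_new sub i_gt0 (esym fs)).
Qed.

(** Old vertices are separated by [face_simple]. An inner vertex could only repeat on the opposite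
    dart, which lies on a different face. *)
Lemma sub_source_inj d d' i j : face_of d = face_of d' ->
  source (p d i) = source (p d' j) -> d = d' /\ i = j.
Proof.
move=> fd; have [i0|i_gt0] := posnP i.
  have -> : i = ord0 by apply: val_inj.
  move=> sE; have j0 := sub_source_start sE; move: sE; rewrite j0 !(sub_start sub).
  by move/(sub_vertex_inj sub)/(face_simple connR fd).
have [j0|j_gt0] := posnP j.
  have -> : j = ord0 by apply: val_inj.
  by move=> /esym/sub_source_start i0; rewrite i0 in i_gt0.
case/(sub_inner_inj sub i_gt0 j_gt0) => [[-> ->]//|[d'E _]].
by have := face_of_opposite_neq connR d; rewrite -d'E fd eqxx.
Qed.

(** A longest face of [R] becomes a face of [G] on which the sources of the darts [p d i] are
    distinct. *)
Lemma max_face_degree_sub : k.+1 * max_face_length R <= max_face_degree G.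
Proof.
have [|d _ dL] := @eq_bigmax_cond _ [in [set: dart R]] (fun d => #|face_of d|).
  have [|v _] := exists_outside3 connR (S := set0); first by rewrite cards0.
  have /card_gt0P[d _] := leq_trans (isT : 0 < 3) (degree_ge3 connR v).
  by apply/card_gt0P; exists d; rewrite !inE.
have -> : max_face_length R = #|face_of d|.
  by rewrite -dL; apply: eq_bigl => x; rewrite !inE.
apply: (@leq_trans (face_degree (face_of (p d ord0)))); last first.
  by apply: leq_bigmax_cond; apply: imset_f.
rewrite /face_degree.
have -> : k.+1 * #|face_of d| = #|setX (face_of d) [set: 'I_k.+1]|.
  by rewrite cardsX cardsT card_ord mulnC.
rewrite -(card_in_imset (f := fun x => source (p x.1 x.2))).
  apply/subset_leq_card/subsetP => _ /imsetP[[d' i] + ->]; rewrite !inE andbT /= => dd'.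
  apply/face_verticesP; exists (p d' i) => //; apply: sub_face.
  by apply/esym/eqP; rewrite eq_face_of.
move=> [d1 i1] [d2 i2]; rewrite !inE !andbT -!eq_face_of /= => /eqP f1 /eqP f2.
by case/sub_source_inj; rewrite -?f1 // => -> ->.
Qed.

Lemma degree_sub_vertex v : 3 <= degree (f v).
Proof.
apply: leq_trans (degree_ge3 connR v) _; rewrite /degree.
rewrite -(card_in_imset (f := fun d => p d ord0)); last by move=> d d' _ _ /sub_dart_inj[].
apply/subset_leq_card/subsetP => _ /imsetP[d + ->]; rewrite !inE => /eqP <-.
by rewrite (sub_start sub).
Qed.

(** If [k] were 0, every vertex of [G] would come from [R] and have degree at least 3. *)
Lemma sub_length_gt0 : 1 <= longest_deg2_path G -> 0 < k.
Proof.
move=> tG; have [k0|//] := posnP k; move: tG; rewrite leqNgt => /negP[].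
rewrite ltnS; apply/bigmax_leqP => -[n nV] /= /existsP[[[|w s] /= /eqP sn]]; first by rewrite -sn.
case/and3P=> _ _ /= /andP[/eqP deg_w _].
case: (sub_vertex_cover sub w) => [[v wv]|[d [i [i_gt0 _]]]].
  by have := degree_sub_vertex v; rewrite -wv deg_w.
by have := leq_trans i_gt0 (leq_ord i); rewrite k0.
Qed.

Lemma sub_source_surj (w : vertex G) : exists d i, w = source (p d i).
Proof.
case: (sub_vertex_cover sub w) => [[v ->]|[d [i [_ ->]]]]; last by exists d, i.
have /card_gt0P[d] := leq_trans (isT : 0 < 3) (degree_ge3 connR v).
by rewrite inE => /eqP <-; exists d, ord0; rewrite (sub_start sub).
Qed.

Lemma sub_cyclic_coloring : 0 < k ->
  cyclically_colorable G ((3 * (k.+1 * max_face_length R)) %/ 2).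
Proof.
move=> k_gt0; have [cv [ce []]] := vertex_edge_coloring simpleR connR k_gt0.
set N := (_ %/ 2) => -[cvN ceN] cvP ce_opp ceP cveP.
(* The two darts of an edge number its inner vertices from opposite ends. *)
pose orient d := enum_rank d < enum_rank (opposite d).
pose pos d (i : nat) := if orient d then i.-1 else k - i.
pose E d (i : nat) := if i == 0 then cv (source d) else ce d (pos d i).
have posk d (i : 'I_k.+1) : 0 < i -> pos d i < k.
  by rewrite /pos => i_gt0; have := ltn_ord i; case: ifP; lia.
have orient_opp d : orient (opposite d) = ~~ orient d.
  rewrite /orient oppositeK -leqNgt ltn_neqAle; case: eqVneq => //= eq_rank.
  by have := opposite_neq d; rewrite (enum_rank_inj (val_inj eq_rank)) eqxx.
have EN d (i : 'I_k.+1) : E d i < N by rewrite /E; case: (posnP i) => [_|/posk/ceN].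
have E_wd d d' (i j : 'I_k.+1) : source (p d i) = source (p d' j) -> E d i = E d' j.
  have [i0|i_gt0] := posnP i.
    have -> : i = ord0 by apply: val_inj.
    move=> sE; have j0 := sub_source_start sE; move: sE; rewrite j0 !(sub_start sub).
    by move/(sub_vertex_inj sub) => sE; rewrite /E /= sE.
  have [j0|j_gt0] := posnP j.
    have -> : j = ord0 by apply: val_inj.
    by move=> /esym/sub_source_start i0; rewrite i0 in i_gt0.
  case/(sub_inner_inj sub i_gt0 j_gt0) => [[-> ->]//|[-> ij]].
  (* Since [i + j = k + 1], the index [i - 1] from one end equals [k - j] from the other. *)
  rewrite /E !gtn_eqF // ce_opp /pos orient_opp; congr ce.
  by case: (orient d) => /=; lia.
have E_proper d d' (i j : 'I_k.+1) : face_of d = face_of d' -> source (p d i) != source (p d' j) ->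
    E d i != E d' j.
  move=> fd neq; rewrite /E; case: (posnP i) neq => [i0|i_gt0]; case: (posnP j) => [j0|j_gt0] neq.
  - apply: cvP; first by apply/existsP; exists d; rewrite source_face fd source_face.
    apply: contraNneq neq => sE.
    have [-> ->] : i = ord0 /\ j = ord0 by split; apply: val_inj.
    by rewrite !(sub_start sub) sE.
  - by rewrite cveP ?posk // -fd source_face.
  - by rewrite eq_sym cveP ?posk // fd source_face.
  - apply: contraNneq neq => cE.
    have [dE posE] := ceP _ _ _ _ fd (posk d i i_gt0) (posk d' j j_gt0) cE.
    rewrite dE in posE *; apply/eqP; congr (source (p _ _)); apply: val_inj => /=.
    have := ltn_ord i; have := ltn_ord j.
    by move: posE; rewrite /pos; case: ifP => _; lia.
(* The default 0 is never taken, since every vertex of [G] is the source of some [p d i]. *)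
pose C w := if [pick x : dart R * 'I_k.+1 | source (p x.1 x.2) == w] is Some x
  then E x.1 x.2 else 0.
have CE d i : C (source (p d i)) = E d i.
  rewrite /C; case: pickP => [[d' j] /= /eqP sE|none]; first exact: E_wd.
  by have := none (d, i); rewrite /= eqxx.
have CN w : C w < N by have [d [i ->]] := sub_source_surj w; rewrite CE.
apply/existsP; exists [ffun w => Ordinal (CN w)].
apply/forall_inP => _ /imsetP[x _ ->].
apply/forall_inP => u /face_verticesP[y1 <- f1].
apply/forall_inP => v /face_verticesP[y2 <- f2]; apply/implyP.
move: f2; rewrite -f1; have [d1 [i1 ->]] := sub_dart_surj y1.
have [d2 [i2 ->]] := sub_dart_surj y2 => f21 neq.
rewrite !ffunE -(inj_eq val_inj) /= !CE; apply: E_proper neq.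
exact/esym/(face_of_sub f21).
Qed.

End Subdivision.

Theorem corollary5 (G R : plane_graph)
    (simpleR : simple_graph R)
    (connR : k_connected R 3)
    (subGR : regular_subdivision G R)
    (tG : 1 <= longest_deg2_path G) :
  cyclic_chromatic_number G <= (3 * max_face_degree G) %/ 2.
Proof.
have [k [f [p sub]]] := subGR; have k_gt0 := sub_length_gt0 sub connR tG.
rewrite /cyclic_chromatic_number; case: ex_minnP => n _ /(_ _ (sub_cyclic_coloring sub simpleR connR k_gt0)).
move=> /leq_trans; apply; apply: leq_div2r; rewrite leq_mul2l.
exact: max_face_degree_sub sub connR.
Qed.
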